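(* Let $h^{(N)}>0$, $b^{(N)}>0$ be sequences such that $\gamma_N=\frac{Nh^{(N)}}{Nh^{(N)}+b^{(N)}}$ satisfies $\gamma_N=\gamma$ for all $N$, for some fixed $\gamma\in(0,1)$. Let $(I_N^A,\beta_N^A)$ be the minimizer of $F_N$ and $(\hat I_N^A,\hat\beta_N^A)$ the minimizer of $\hat F_N^A$ (both functions defined in the context). Then, as $N\to\infty$, $$\left|\frac{F_N(I_N^A,\beta_N^A)}{F_N(\hat I_N^A,\hat\beta_N^A)}-1\right|=o\left(\frac{1}{\sqrt{\log N}}\right).$$
   Context: Fix $\sigma>0$, $\sigma_A>0$. Let $W_1,W_2,\dots$ be independent Brownian motions started at $0$ with mean $0$ and variance $\sigma^2$ ($\mathrm{Var}(W_i(t))=\sigma^2t$), and $W_A$ a Brownian motion started at $0$ with mean $0$ and variance $\sigma_A^2$, independent of the $W_i$. Let $Q_i=\sup_{s>0}(W_i(s)+W_A(s)-s)$. For $N\ge2$, $I\in\mathbb R$, $\beta>0$ define, with $x^+=\max(x,0)$, $$C_N(I)=\mathbb E\Big[Nh^{(N)}(I-Q_i)+(Nh^{(N)}+b^{(N)})\big(\max_{j\le N}Q_j-I\big)^+\Big],\qquad F_N(I,\beta)=\frac1\beta C_N(I)+\beta N,$$ (the $Q_i$ are identically distributed, so the choice of $i$ is irrelevant) and $$\hat C_N^A(I)=\mathbb E\Big[Nh^{(N)}(I-Q_i)+(Nh^{(N)}+b^{(N)})\big(\tfrac{\sigma^2}{2}\log N+\tfrac{\sigma\sigma_A}{\sqrt2}\sqrt{\log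 N}\,X-I\big)^+\Big],\qquad \hat F_N^A(I,\beta)=\frac1\beta\hat C_N^A(I)+\beta N,$$ with $X\sim\mathcal N(0,1)$. $(I_N^A,\beta_N^A)$ and $(\hat I_N^A,\hat\beta_N^A)$ denote the minimizers of $F_N$ and $\hat F_N^A$ respectively over $I\in\mathbb R$, $\beta>0$ (the latter is considered for all sufficiently large $N$, for which $\hat C_N^A>0$ and it exists). *)

(* Defs.v *)
From mathcomp Require Import all_boot all_order all_algebra.
From mathcomp Require Import all_classical all_reals all_analysis.

Set Implicit Arguments.
Unset Strict Implicit.
Unset Printing Implicit Defensive.

Import Order.TTheory GRing.Theory Num.Theory.
Import numFieldNormedType.Exports.

Local Open Scope classical_set_scope.
Local Open Scope ring_scope.

Section Probability.
Context {d : measure_display} {T : measurableType d} {R : realType}.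
Variable P : probability T R.

Definition mutually_independent (K : eqType) (F : K -> set (set T)) : Prop :=
  forall (J : seq K) (A : K -> set T), uniq J ->
    (forall k, k \in J -> F k (A k)) ->
    (P (\bigcap_(k in [set` J]) A k) = \prod_(k <- J) P (A k))%E.

(* Only the values at times t >= 0 are relevant: a process on [0, +oo[ is
   encoded as a family indexed by all of R, its values at t < 0 being junk. *)
Definition process_sigma_algebra (X : R -> T -> R) : set (set T) :=
  <<s \bigcup_(t in [set t : R | 0 <= t]) g_sigma_algebra_preimage (X t) >>.

Definition independent_processes (K : eqType) (X : K -> R -> T -> R) : Prop :=
  mutually_independent (fun k => process_sigma_algebra (X k)).

(* The equality of laws is restricted to measurable sets, since P carries no
   information on non-measurable ones. normal_prob takes the standard
   deviation as parameter. *)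
Definition normal_rv (m s : R) (X : T -> R) : Prop :=
  forall A : set R, measurable A -> pushforward P X A = normal_prob m s A.

(* Mean 0 and variance s ^+ 2, i.e. the variance at time t is s ^+ 2 * t. *)
Definition brownian_motion (s : R) (B : R -> {RV P >-> R}) : Prop :=
  [/\ forall w, B 0 w = 0,
      forall w, {within `[0, +oo[, continuous (fun t => B t w)},
      forall u t : R, 0 <= u -> u < t ->
        normal_rv 0 (s * Num.sqrt (t - u)) (B t \- B u)
    & forall t : R^nat, 0 <= t 0%N -> nondecreasing_seq t ->
        mutually_independent
          (fun k : nat => g_sigma_algebra_preimage (B (t k.+1) \- B (t k)))].

(* The supremum is finite outside of a P-negligible set (the drift is
   negative), on which sup takes a default value. *)
Definition max_queue (W : nat -> R -> {RV P >-> R}) (WA : R -> {RV P >-> R})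
    (i : nat) (w : T) : R :=
  sup [set W i s w + WA s w - s | s in [set s : R | 0 < s]].

(* For 0 < N this is the maximum of Q 0, ..., Q N.-1. *)
Definition max_of (Q : nat -> T -> R) (N : nat) (w : T) : R :=
  \big[Num.max/Q 0%N w]_(j < N) Q j w.

(* Y and M are integrable in both uses below, so the expectation is finite
   and fine loses nothing. *)
Definition expected_cost (h b : R) (N : nat) (Y M : T -> R) (I : R) : R :=
  fine ('E_P[fun w => (N%:R * h * (I - Y w)
                      + (N%:R * h + b) * Num.max (M w - I) 0)%R])%E.

(* The queues are indexed from 0. They are identically distributed, and Q 0
   represents the generic Q_i. *)
Definition C (h b : nat -> R) (Q : nat -> T -> R) (N : nat) (I : R) : R :=
  expected_cost (h N) (b N) N (Q 0%N) (max_of Q N) I.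

Definition Chat (sigma sigmaA : R) (h b : nat -> R) (Q : nat -> T -> R)
    (X : T -> R) (N : nat) (I : R) : R :=
  expected_cost (h N) (b N) N (Q 0%N)
    (fun w => sigma ^+ 2 / 2 * ln N%:R
      + sigma * sigmaA / Num.sqrt 2 * Num.sqrt (ln N%:R) * X w) I.

End Probability.

Definition total_cost {R : realType} (c : nat -> R -> R) (N : nat)
    (I beta : R) : R :=
  beta^-1 * c N I + beta * N%:R.

Definition is_minimizer {R : realType} (F : R -> R -> R) (I beta : R) : Prop :=
  0 < beta /\ forall I' beta' : R, 0 < beta' -> F I beta <= F I' beta'.

(* Main.v *)
From HB Require Import structures.
Require Import Defs.
From mathcomp Require Import all_boot all_order all_algebra.
From mathcomp Require Import all_classical all_reals all_analysis.
From mathcomp Require Import measurable_realfun ring lra.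

(* Write L = ln N, s = sigma^2 L / 2 and M for the maximum of the N queues. The
   paths W_j(u) - u reach the level s near time s, so M should be close to
   s + W_A(s), which has the same law as the Gaussian approximation of M.
   Upper bound: for a small slope delta, |W_A(u) - W_A(s)| exceeds
   delta |u - s| by an amount of order 1 / delta, uniformly in u, while the
   suprema of W_j(u) - (1 -+ delta) u have exponential tails with rate
   2 (1 -+ delta) / sigma^2 (maximal inequality for the exponential
   supermartingale), so that a union bound over j < N gives
   M <= s + W_A(s) + O(delta^2 L + 1 / delta); take delta of order L^(-1/4).
   Lower bound: M >= W_j(s) + W_A(s) - s for every j, and the maximum of N
   independent Gaussians of variance sigma^2 s is at least
   2 s - eps sqrt L with overwhelming probability.
   Hence E|M - s - W_A(s)| = o(sqrt L), which bounds the gap between the two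
   normalized costs uniformly in I. As the costs are of order L, the total costs
   F and Fhat agree up to a factor 1 + o(1 / sqrt L) uniformly in (I, beta), and
   so do their values at either minimizer. *)

Set Implicit Arguments.
Unset Strict Implicit.
Unset Printing Implicit Defensive.

Import Order.TTheory GRing.Theory Num.Theory.
Import numFieldNormedType.Exports.

Local Open Scope classical_set_scope.
Local Open Scope ring_scope.

Section independence.
Context {d : measure_display} {T : measurableType d} {R : realType}.
Variable P : probability T R.
Local Open Scope ereal_scope.

Lemma indep_ge0_integralM (U V : {RV P >-> R}) :
  (forall w, 0 <= U w)%R -> (forall w, 0 <= V w)%R ->
  (forall A B : set R, measurable A -> measurable B ->
    P (U @^-1` A `&` V @^-1` B) = P (U @^-1` A) * P (V @^-1` B)) ->
  \int[P]_w (U w * V w)%:E = \int[P]_w (U w)%:E * \int[P]_w (V w)%:E.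
Proof.
move=> U0 V0 UV.
have mUV : measurable_fun setT (fun w => (U w, V w)) by exact: measurable_fun_pair.
pose UVf : {RV P >-> (R * R)%type} := HB.pack (fun w => (U w, V w))
  (isMeasurableFun.Build _ _ _ _ (fun w => (U w, V w)) mUV).
pose m1 := distribution P U.
pose m2 := distribution P V.
pose f : R * R -> \bar R := fun z => (`|z.1| * `|z.2|)%:E.
have mf : measurable_fun setT f.
  apply/measurable_EFinP; apply: measurable_funM.
    apply: measurableT_comp => //; exact: measurable_fst.
  apply: measurableT_comp => //; exact: measurable_snd.
have f0 z : 0 <= f z by rewrite lee_fin mulr_ge0.
transitivity (\int[distribution P UVf]_z f z).
  rewrite ge0_integral_distribution//=.
  by apply: eq_integral => w _; rewrite /f/= !ger0_norm.
transitivity (\int[m1 \x m2]_z f z).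
  apply: eq_measure_integral => //= A mA _; apply/esym.
  exact: product_measure_unique.
rewrite fubini_tonelli1//= /fubini_F /f/=.
have mn D : measurable_fun D (fun y : R => `|y|%:E).
  by apply/measurable_EFinP; exact: normr_measurable.
under eq_integral.
  move=> x _; under eq_integral do rewrite EFinM.
  rewrite ge0_integralZl//=; over.
rewrite ge0_integralZr//=; last exact: integral_ge0.
rewrite !ge0_integral_distribution//=.
by congr (_ * _); apply: eq_integral => w _; rewrite /= ger0_norm.
Qed.

End independence.

Section past.
Context {d : measure_display} {T : measurableType d} {R : realType}.
Variable P : probability T R.
Local Open Scope ereal_scope.

Lemma preimage_algebra (f : T -> R) (A : set R) : measurable A ->
  g_sigma_algebra_preimage f (f @^-1` A).
Proof. by move=> mA; exists A => //; rewrite setTI. Qed.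

Lemma preimage_algebra_measurable (f : {RV P >-> R}) :
  g_sigma_algebra_preimage f `<=` measurable.
Proof. by move=> _ [B mB <-]; exact: measurable_funP. Qed.

Lemma past_indep (xi : nat -> {RV P >-> R}) (n : nat) (A B : set T) :
  mutually_independent P (fun k => g_sigma_algebra_preimage (xi k)) ->
  <<s \bigcup_(i in `I_n) g_sigma_algebra_preimage (xi i) >> A ->
  g_sigma_algebra_preimage (xi n) B ->
  P (A `&` B) = P A * P B.
Proof.
move=> indep sA FB.
pose F k := g_sigma_algebra_preimage (xi k).
have mF k C : F k C -> measurable C by exact: preimage_algebra_measurable.
have mB : measurable B by exact: mF FB.
have FT k : F k setT by rewrite -(preimage_setT (xi k)); exact: preimage_algebra.
pose G := [set \bigcap_(k < n) C k | C in [set C : nat -> set T | forall k, F k (C k)]].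
have Gm : G `<=` measurable.
  by move=> _ [C FC <-]; apply: bigcap_measurableType => k _; exact/mF/FC.
have GT : G setT by exists (fun _ => setT) => //; exact: bigcapT.
have GI : setI_closed G.
  move=> _ _ [C FC <-] [D FD <-]; exists (fun k => C k `&` D k); last exact: bigcapI.
  by move=> k; move: (FC k) (FD k) => [C' mC' <-] [D' mD' <-];
    exists (C' `&` D'); [exact: measurableI|rewrite !setTI].
have PB0 : (0 <= fine (P B))%R by rewrite fine_ge0.
have PBE : (fine (P B))%:E = P B by rewrite fineK// fin_num_measure.
have sub : <<s \bigcup_(i in `I_n) F i >> `<=` <<s G >>.
  apply: sub_sigma_algebra2 => C [i ltin FiC].
  exists (fun k => if k == i then C else setT).
    by move=> k; case: eqP => // ->.
  apply/seteqP; split => [w /(_ i ltin)/=|w Cw k _ /=]; first by rewrite eqxx.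
  by case: ifP.
have prod (C : nat -> set T) m : (forall k, F k (C k)) ->
    P (\bigcap_(k < m) C k) = \prod_(k < m) P (C k).
  move=> FC; have := indep (iota 0 m) C (iota_uniq _ _) (fun k _ => FC k).
  rewrite -(big_mkord xpredT (fun k => P (C k))) /index_iota subn0 => <-; congr (P _).
  by apply: eq_bigcapl; split=> k /=; rewrite mem_iota.
pose m1 : {measure set T -> \bar R} := mrestr P mB.
pose m2 : {measure set T -> \bar R} := mscale (NngNum PB0) P.
have m1E C : m1 C = P (C `&` B) by [].
have m2E C : m2 C = P B * P C by rewrite -[in RHS]PBE.
have : m1 A = m2 A.
  apply: (g_sigma_algebra_measure_unique G Gm (fun=> setT)) => //.
  - by rewrite bigcup_const.
  - move=> _ [C FC <-]; rewrite m1E m2E.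
    pose C' k := if k == n then B else C k.
    have FC' k : F k (C' k) by rewrite /C'; case: eqP => // ->.
    have C'E k : (k < n)%N -> C' k = C k.
      by move=> kn; rewrite /C' ltn_eqF.
    have := prod C' n.+1 FC'.
    rewrite bigcap_mkord !big_ord_recr/= {2 4}/C' eqxx.
    under eq_bigr do rewrite C'E//.
    under [in X in _ = X -> _]eq_bigr do rewrite C'E//.
    by rewrite -bigcap_mkord -prod// muleC => ->.
  - by move=> k; rewrite m1E ltey_eq fin_num_measure//; exact: measurableI.
  - exact: sub.
by rewrite m1E m2E muleC.
Qed.

End past.

Section maximal.
Context {d : measure_display} {T : measurableType d} {R : realType}.
Variable P : probability T R.
Local Open Scope ereal_scope.

Section walk.
Variables (xi : nat -> {RV P >-> R}) (x : R).

Let S k w : R := (\sum_(i < k) xi i w)%R.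

Fixpoint stays_below n w : bool :=
  if n is m.+1 then stays_below m w && (S m.+1 w <= x)%R else true.

Lemma stays_belowP n w : (0 <= x)%R ->
  ~~ stays_below n w <-> exists2 k, (k <= n)%N & (x < S k w)%R.
Proof.
move=> x0; elim: n => [|n IH] /=.
  by split=> // -[k]; rewrite leqn0 => /eqP ->; rewrite /S big_ord0 ltNge x0.
rewrite negb_and -ltNge; split.
  by move=> /orP[/IH[k kn xk]|xn]; [exists k => //; exact: leqW|exists n.+1].
move=> [k]; rewrite leq_eqVlt => /predU1P[-> ->|kn xk]; first exact: orbT.
by apply/orP; left; apply/IH; exists k.
Qed.

Let Past n := g_sigma_algebraType
  (\bigcup_(i in `I_n) g_sigma_algebra_preimage (xi i)).

Let measurable_past (f : T -> R) n (B : set R) :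
  measurable_fun [set: Past n] (f : Past n -> R) -> measurable B ->
  <<s \bigcup_(i in `I_n) g_sigma_algebra_preimage (xi i) >> (f @^-1` B).
Proof. by move=> mf mB; have := mf measurableT _ mB; rewrite setTI. Qed.

Let past_measurable (f : T -> R) n :
  measurable_fun [set: Past n] (f : Past n -> R) -> measurable_fun setT f.
Proof.
move=> mf _ B mB; rewrite setTI; have := measurable_past mf mB.
apply: smallest_sub; first exact: sigma_algebra_measurable.
by move=> A [i _]; exact: preimage_algebra_measurable.
Qed.

Let mxi i n : (i < n)%N -> measurable_fun [set: Past n] (xi i : Past n -> R).
Proof.
move=> ltin _ B mB; rewrite setTI; apply: sub_sigma_algebra; exists i => //.
exact: preimage_algebra.
Qed.

Let mS k n : (k <= n)%N -> measurable_fun [set: Past n] (S k : Past n -> R).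
Proof.
elim: k => [_|k IH kn].
  by rewrite (_ : S 0 = cst 0%R) //; apply/funext => w; rewrite /S big_ord0.
rewrite (_ : S k.+1 = (S k \+ xi k)%R); last first.
  by apply/funext => w; rewrite /S big_ord_recr.
by apply: measurable_funD; [exact: (IH (ltnW kn))|exact: mxi].
Qed.

Let mbelow k n : (k <= n)%N ->
  measurable_fun [set: Past n] (stays_below k : Past n -> bool).
Proof.
elim: k => [_|k IH kn] /=; first exact: measurable_cst.
apply: measurable_and; first exact: (IH (ltnW kn)).
by apply: measurable_fun_ler; [exact: mS|exact: measurable_cst].
Qed.

Let stopped n w : R := if stays_below n w then expR (S n w) else expR x.

Let mstopped n : measurable_fun setT (stopped n).
Proof.
apply: (@past_measurable _ n); apply: measurable_fun_ifT; first exact: mbelow.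
  by apply: measurableT_comp => //; exact: mS.
exact: measurable_cst.
Qed.

Hypothesis indep :
  mutually_independent P (fun k => g_sigma_algebra_preimage (xi k)).
Hypothesis xi_le1 : forall k, \int[P]_w (expR (xi k w))%:E <= 1.

Let stopped_step n : \int[P]_w (stopped n.+1 w)%:E <= \int[P]_w (stopped n w)%:E.
Proof.
pose A w : R := if stays_below n w then expR (S n w) else 0%R.
pose D w : R := if stays_below n w then 0%R else expR x.
have mA' : measurable_fun [set: Past n] (A : Past n -> R).
  apply: measurable_fun_ifT; first exact: mbelow.
    by apply: measurableT_comp => //; exact: mS.
  exact: measurable_cst.
have mA := past_measurable mA'.
have mD : measurable_fun setT D.
  apply: (@past_measurable _ n); apply: measurable_fun_ifT.
  - exact: mbelow.
  - exact: measurable_cst.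
  - exact: measurable_cst.
have A0 w : (0 <= A w)%R by rewrite /A; case: ifP => // _; exact: expR_ge0.
have D0 w : (0 <= D w)%R by rewrite /D; case: ifP => // _; exact: expR_ge0.
have mV : measurable_fun setT (expR \o xi n) by exact: measurableT_comp.
pose AV : {RV P >-> R} := HB.pack A (isMeasurableFun.Build _ _ _ _ A mA).
pose VV : {RV P >-> R} := HB.pack (expR \o xi n)
  (isMeasurableFun.Build _ _ _ _ (expR \o xi n) mV).
have mul : \int[P]_w (A w * expR (xi n w))%:E =
    \int[P]_w (A w)%:E * \int[P]_w (expR (xi n w))%:E.
  apply: (@indep_ge0_integralM _ _ _ P AV VV) => // [w|B C mB mC].
    exact: expR_ge0.
  apply: (past_indep indep (measurable_past mA' mB)).
  rewrite -[(expR \o xi n) @^-1` C]/(xi n @^-1` (expR @^-1` C)).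
  apply: preimage_algebra; rewrite -[_ @^-1` _]setTI.
  exact: measurable_expR.
apply: (@le_trans _ _ (\int[P]_w ((A w * expR (xi n w))%:E + (D w)%:E))).
  apply: ge0_le_integral => //=.
  - by move=> w _; rewrite lee_fin /stopped; case: ifP => _; exact: expR_ge0.
  - by apply/measurable_EFinP; exact: mstopped.
  - by apply/measurable_EFinP/measurable_funD => //; exact: measurable_funM.
  - move=> w _; rewrite -EFinD lee_fin /stopped /A /D /=.
    case: stays_below => /=; last by rewrite mul0r add0r.
    rewrite addr0 -expRD /S big_ord_recr/=; case: ifP => // /negbT.
    by rewrite -ltNge => /ltW; rewrite ler_expR.
rewrite ge0_integralD//=; last 4 first.
- by move=> w _; rewrite lee_fin mulr_ge0// expR_ge0.
- by apply/measurable_EFinP/measurable_funM.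
- by move=> w _; rewrite lee_fin.
- exact/measurable_EFinP.
rewrite mul.
apply: (@le_trans _ _ (\int[P]_w (A w)%:E + \int[P]_w (D w)%:E)).
  rewrite leeD2r// -[leRHS]mule1 lee_wpmul2l//.
  by apply: integral_ge0 => w _; rewrite lee_fin.
rewrite -ge0_integralD//=; last 4 first.
- by move=> w _; rewrite lee_fin.
- exact/measurable_EFinP.
- by move=> w _; rewrite lee_fin.
- exact/measurable_EFinP.
rewrite le_eqVlt; apply/orP; left; apply/eqP; apply: eq_integral => w _.
by rewrite -EFinD /A /D /stopped; case: ifP; rewrite ?addr0 ?add0r.
Qed.

Lemma measurable_stays_below n : measurable [set w | ~~ stays_below n w].
Proof.
have m : measurable_fun setT (fun w => ((stays_below n w)%:R : R)).
  apply: (@past_measurable _ n).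
  rewrite (_ : (fun _ => _) = (fun w => if stays_below n w then 1 else 0)%R).
    apply: measurable_fun_ifT; [exact: mbelow|exact: measurable_cst..].
  by apply/funext => w; case: ifP.
rewrite (_ : mkset _ = (fun w => ((stays_below n w)%:R : R)) @^-1` [set 0%R]).
  by rewrite -[_ @^-1` _]setTI; exact: m.
apply/seteqP; split=> w /=; first by move=> /negbTE ->.
by case: stays_below => //= /eqP; rewrite oner_eq0.
Qed.

Lemma maximal_ineq n : (0 <= x)%R ->
  P [set w | ~~ stays_below n w] <= (expR (- x))%:E.
Proof.
move=> x0.
have U1 : \int[P]_w (stopped n w)%:E <= 1.
  elim: n => [|n IH]; last exact: le_trans (stopped_step n) IH.
  rewrite (eq_integral (cst 1)); last first.
    by move=> w _; rewrite /stopped/= /S big_ord0 expR0.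
  by rewrite integral_cst// mul1e probability_le1.
have mE := measurable_stays_below n.
rewrite -(@lee_pmul2l _ (expR x)%:E) ?fin_numE// ?lte_fin ?expR_gt0//.
rewrite -EFinM -expRD subrr expR0; apply: le_trans U1.
rewrite -integral_cst//.
rewrite integral_mkcond.
apply: ge0_le_integral => //=.
- by move=> w _; rewrite patchE; case: ifP => // _; rewrite lee_fin expR_ge0.
- by apply/(measurable_restrictT _ mE); exact: measurable_cst.
- by apply/measurable_EFinP; exact: mstopped.
move=> w _; rewrite patchE /stopped; case: ifPn.
  by rewrite inE /= => /negbTE ->.
by rewrite notin_setE /= => _; rewrite lee_fin; case: ifP => _; exact: expR_ge0.
Qed.

End walk.
End maximal.

Section dyadic.
Context {R : realType}.
Implicit Types (a u e x : R) (f : R -> R) (D : set R).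

Lemma within_continuous_gt f D u x : {within D, continuous f} -> D u ->
  x < f u -> exists2 e, 0 < e & forall v, D v -> `|u - v| < e -> x < f v.
Proof.
move=> /subspace_continuousP cf Du xfu.
have : nbhs u [set v | D v -> x < f v].
  exact: (cvgr_gt (f u) (cf u Du) x xfu).
move=> /nbhs_ballP[e /= e0 he].
by exists e => // v Dv uv; exact: he.
Qed.

Lemma dyadic_approx a u e : 0 < a -> 0 <= u <= a -> 0 < e ->
  exists n k : nat, (k <= 2 ^ n)%N /\ `|u - a * (k%:R / (2 ^ n)%:R)| < e.
Proof.
move=> a0 /andP[u0 ua] e0.
pose n := Num.truncn (a / e).
have p0 : 0 < (2 ^ n)%:R :> R by rewrite ltr0n expn_gt0.
have an : a / (2 ^ n)%:R < e.
  rewrite ltr_pdivrMr// mulrC -ltr_pdivrMr//.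
  apply: lt_le_trans (truncnS_gt _) _; rewrite ler_nat.
  exact: ltn_expl.
pose y := u / a * (2 ^ n)%:R.
have y0 : 0 <= y by rewrite mulr_ge0// ?divr_ge0// ltW.
have yle : y <= (2 ^ n)%:R by rewrite ler_piMl// ?(ltW p0)// ler_pdivrMr// mul1r.
exists n, (Num.truncn y); split.
  by rewrite -(ler_nat R); apply: le_trans yle; rewrite truncn_le.
have /andP[yl yu] := truncn_itv y0.
have uE : u = a * (y / (2 ^ n)%:R) by rewrite /y; field; rewrite !gt_eqF.
rewrite {1}uE -mulrBr -mulrBl ger0_norm; last first.
  by rewrite mulr_ge0 ?(ltW a0)// divr_ge0 ?(ltW p0)// subr_ge0.
apply: le_lt_trans an; rewrite mulrA ler_pM2r ?invr_gt0// ler_piMr ?(ltW a0)//.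
by rewrite lerBlDl -natr1 in yu *; exact: ltW.
Qed.

End dyadic.

Section exceed.
Context {d : measure_display} {T : measurableType d} {R : realType}.
Implicit Types (a x : R) (Z : R -> T -> R).

Definition exceeds Z D x := [set w | exists2 u : R, D u & x < Z u w].

Lemma exceeds_itvE Z a x : 0 < a ->
  (forall w, {within `[0, a], continuous (Z^~ w)}) ->
  exceeds Z `[0, a]%classic x = \bigcup_n [set w | exists2 k, (k <= 2 ^ n)%N &
    x < Z (a * (k%:R / (2 ^ n)%:R)) w].
Proof.
move=> a0 cZ; apply/seteqP; split=> w /=.
  move=> [u ua xZ]; have [e e0 he] := within_continuous_gt (cZ w) ua xZ.
  have ua' : 0 <= u <= a by move: ua; rewrite /= in_itv.
  have [n [k [kn uk]]] := dyadic_approx a0 ua' e0.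
  exists n => //; exists k => //; apply: he => //=.
  rewrite in_itv/= mulr_ge0 ?(ltW a0) ?divr_ge0//= ler_piMr ?(ltW a0)//.
  by rewrite ler_pdivrMr ?ltr0n ?expn_gt0// mul1r ler_nat.
move=> [n _ [k kn xZ]]; exists (a * (k%:R / (2 ^ n)%:R)) => //.
rewrite /= in_itv/= mulr_ge0 ?(ltW a0) ?divr_ge0//= ler_piMr ?(ltW a0)//.
by rewrite ler_pdivrMr ?ltr0n ?expn_gt0// mul1r ler_nat.
Qed.

Lemma exceeds_halflineE Z x :
  exceeds Z `[0, +oo[%classic x = \bigcup_n exceeds Z `[0, n.+1%:R]%classic x.
Proof.
apply/seteqP; split=> w /=.
  move=> [u]; rewrite /= in_itv /= andbT => u0 xZ.
  exists (Num.truncn u) => //; exists u => //.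
  by rewrite /= in_itv/= u0 ltW// truncnS_gt.
move=> [n _ [u]]; rewrite /= in_itv/= => /andP[u0 _] xZ.
by exists u => //=; rewrite in_itv/= u0.
Qed.

Lemma measurable_exceeds_itv Z a x : 0 < a ->
  (forall w, {within `[0, a], continuous (Z^~ w)}) ->
  (forall u, measurable_fun setT (Z u)) -> measurable (exceeds Z `[0, a]%classic x).
Proof.
move=> a0 cZ mZ; rewrite exceeds_itvE//; apply: bigcupT_measurable => n.
rewrite (_ : mkset _ = \bigcup_(k < (2 ^ n).+1)
    (Z (a * (k%:R / (2 ^ n)%:R)) @^-1` `]x, +oo[)).
  apply: bigcup_measurable => k _; rewrite -[_ @^-1` _]setTI.
  exact: mZ.
by apply/seteqP; split=> w /= [k kn xZ]; exists k => //;
  move: xZ; rewrite /= in_itv/= andbT.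
Qed.

Lemma measurable_exceeds_halfline Z x :
  (forall w, {within `[0, +oo[, continuous (Z^~ w)}) ->
  (forall u, measurable_fun setT (Z u)) -> measurable (exceeds Z `[0, +oo[%classic x).
Proof.
move=> cZ mZ; rewrite exceeds_halflineE; apply: bigcupT_measurable => n.
apply: measurable_exceeds_itv => // w; apply: continuous_subspaceW (cZ w).
by move=> u /=; rewrite !in_itv/= andbT => /andP[].
Qed.

End exceed.

Section exceed_probability.
Context {d : measure_display} {T : measurableType d} {R : realType}.
Variable P : probability T R.
Implicit Types (a x : R) (Z : R -> T -> R).

Lemma bigcup_nondecreasing_le (F : nat -> set T) (c : \bar R) :
  (forall n, measurable (F n)) -> nondecreasing_seq F ->
  (forall n, (P (F n) <= c)%E) -> (P (\bigcup_n F n) <= c)%E.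
Proof.
move=> mF ndF Fc.
have cvgF := nondecreasing_cvg_mu (mu := P) mF (bigcupT_measurable _ mF) ndF.
rewrite -(cvg_lim _ cvgF)//; apply: lime_le; first by apply/cvg_ex; eexists; exact: cvgF.
by apply: nearW => n; exact: Fc.
Qed.

Definition exp_supermartingale_grid Z a := forall n,
  exists xi : nat -> {RV P >-> R},
  [/\ mutually_independent P (fun k => g_sigma_algebra_preimage (xi k)),
      forall k, (\int[P]_w (expR (xi k w))%:E <= 1)%E
    & forall k w, (k <= 2 ^ n)%N ->
      Z (a * (k%:R / (2 ^ n)%:R)) w = \sum_(i < k) xi i w].

Lemma exceeds_itv_le Z a x : 0 < a -> 0 <= x ->
  (forall w, {within `[0, a], continuous (Z^~ w)}) ->
  exp_supermartingale_grid Z a ->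
  (P (exceeds Z `[0%R, a]%classic x) <= (expR (- x))%:E)%E.
Proof.
move=> a0 x0 cZ gZ; rewrite exceeds_itvE//.
have E n : exists xi : nat -> {RV P >-> R},
   [/\ mutually_independent P (fun k => g_sigma_algebra_preimage (xi k)),
      forall k, (\int[P]_w (expR (xi k w))%:E <= 1)%E &
   [set w | exists2 k, (k <= 2 ^ n)%N & x < Z (a * (k%:R / (2 ^ n)%:R)) w] =
   [set w | ~~ stays_below xi x (2 ^ n) w]].
  have [xi [indep xi1 Zxi]] := gZ n; exists xi; split => //.
  apply/seteqP; split => w /=.
    by move=> [k kn xZ]; apply/stays_belowP => //; exists k; rewrite -?Zxi.
  by move=> /stays_belowP[//|k kn xZ]; exists k; rewrite ?Zxi.
apply: bigcup_nondecreasing_le.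
- by move=> n; have [xi [_ _ ->]] := E n; exact: measurable_stays_below.
- apply/nondecreasing_seqP => n; apply/subsetPset => w /= [k kn xZ].
  exists (k * 2)%N; first by rewrite expnSr leq_mul2r kn.
  move: xZ; congr (_ < Z (_ * _) w); rewrite expnSr !natrM.
  by field; rewrite pnatr_eq0 expn_eq0.
- by move=> n; have [xi [indep xi1 ->]] := E n; exact: maximal_ineq.
Qed.

Lemma exceeds_halfline_le Z x : 0 <= x ->
  (forall w, {within `[0, +oo[, continuous (Z^~ w)}) ->
  (forall u, measurable_fun setT (Z u)) ->
  (forall a, 0 < a -> exp_supermartingale_grid Z a) ->
  (P (exceeds Z `[0%R, +oo[%classic x) <= (expR (- x))%:E)%E.
Proof.
move=> x0 cZ mZ gZ; rewrite exceeds_halflineE.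
have cZn n w : {within `[0, n.+1%:R], continuous (Z^~ w)}.
  apply: continuous_subspaceW (cZ w).
  by move=> u /=; rewrite !in_itv/= andbT => /andP[].
apply: bigcup_nondecreasing_le.
- by move=> n; exact: measurable_exceeds_itv.
- apply/nondecreasing_seqP => n; apply/subsetPset => w /= [u].
  rewrite /= in_itv/= => /andP[u0 un] xZ; exists u => //=.
  by rewrite in_itv/= u0 (le_trans un)// ler_nat.
- by move=> n; apply: exceeds_itv_le => //; exact: gZ.
Qed.

End exceed_probability.

Section density.
Import HBNNSimple.
Local Open Scope ereal_scope.

Lemma ge0_integral_density d (T : measurableType d) (R : realType)
    (mu nu : {measure set T -> \bar R}) (p : T -> R) (f : T -> \bar R) :
  measurable_fun setT p -> (forall x, 0 <= p x)%R ->
  (forall A, measurable A -> nu A = \int[mu]_(x in A) (p x)%:E) ->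
  measurable_fun setT f -> (forall x, 0 <= f x) ->
  \int[nu]_x f x = \int[mu]_x (f x * (p x)%:E).
Proof.
move=> mp p0 nuE mf f0.
have mpE : measurable_fun setT (EFin \o p) by exact/measurable_EFinP.
pose f_ := nnsfun_approx measurableT mf.
have ind (g : {nnsfun T >-> R}) :
    \int[nu]_x (g x)%:E = \int[mu]_x ((g x)%:E * (p x)%:E).
  transitivity (\sum_(k \in range g) \int[nu]_x (k * \1_(g @^-1` [set k]) x)%:E).
    under eq_integral do rewrite fimfunE -fsumEFin//.
    rewrite ge0_integral_fsum//.
    - by move=> y; exact/measurable_EFinP/measurable_funM.
    - by move=> y x _; rewrite nnfun_muleindic_ge0.
  transitivity (\sum_(k \in range g)
      \int[mu]_x ((k * \1_(g @^-1` [set k]) x)%:E * (p x)%:E)); last first.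
    rewrite -ge0_integral_fsum//.
    - apply: eq_integral => x _; rewrite [in RHS]fimfunE -fsumEFin//.
      by rewrite ge0_mule_fsuml// => k; exact: nnfun_muleindic_ge0.
    - move=> k; apply: emeasurable_funM => //.
      exact/measurable_EFinP/measurable_funM.
    - by move=> k x _; rewrite mule_ge0// ?nnfun_muleindic_ge0// lee_fin.
  apply: eq_fsbigr => k /[!inE] -[x _ gxk].
  have k0 : (0 <= k)%R by rewrite -gxk.
  under eq_integral do rewrite EFinM.
  rewrite ge0_integralZl//=; last exact/measurable_EFinP.
  under [RHS]eq_integral do rewrite EFinM -muleA.
  rewrite ge0_integralZl//=; last 2 first.
  - apply: emeasurable_funM => //; exact/measurable_EFinP.
  - by move=> y _; rewrite mule_ge0// lee_fin.
  rewrite integral_indic// setIT nuE// integral_mkcond; congr (_ * _).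
  by apply: eq_integral => y _; rewrite patchE indicE; case: ifP => _;
    rewrite ?mul1e ?mul0e.
transitivity (limn (fun n => \int[nu]_x (f_ n x)%:E)).
  rewrite -monotone_convergence//.
  - by apply: eq_integral => x _; apply/esym/cvg_lim => //; exact: cvg_nnsfun_approx.
  - by move=> n; exact/measurable_EFinP.
  - by move=> n x _; rewrite lee_fin.
  - by move=> x _ m n mn; rewrite lee_fin; exact/lefP/nd_nnsfun_approx.
under eq_fun do rewrite ind.
rewrite -monotone_convergence//.
- apply: eq_integral => x _; apply/cvg_lim => //.
  by apply: cvgeZr => //; exact: cvg_nnsfun_approx.
- by move=> n; apply: emeasurable_funM => //; exact/measurable_EFinP.
- by move=> n x _; rewrite mule_ge0// lee_fin.
- move=> x _ m n mn; rewrite lee_wpmul2r ?lee_fin//.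
  exact/lefP/nd_nnsfun_approx.
Qed.

End density.

Section lebesgue.
Context {R : realType}.
Local Open Scope ereal_scope.
Let mu : {measure set (measurableTypeR R) -> \bar R} := @lebesgue_measure R.

Lemma ge0_integral_dilation (k : R) (f : R -> \bar R) : (0 < k)%R ->
  measurable_fun setT f -> (forall x, 0 <= f x) ->
  \int[mu]_x f x = k%:E * \int[mu]_x f (k * x)%R.
Proof.
move=> k0 mf f0.
pose phi : measurableTypeR R -> measurableTypeR R := fun x => (k * x)%R.
have mphi : measurable_fun setT phi by exact: mulrl_measurable.
have kn0 : (0 <= k)%R by exact: ltW.
have muE (u v : R) : mu `]u, v]%classic = if (u < v)%R then (v - u)%:E else 0.
  by have /= := lebesgue_measure_itv `]u, v]; rewrite lte_fin EFinB; exact.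
pose push : {measure set (measurableTypeR R) -> \bar R} :=
  measure_function_pushforward__canonical__measure_function_Measure mu mphi.
pose nu : {measure set (measurableTypeR R) -> \bar R} :=
  mscale (NngNum kn0) push.
transitivity (\int[nu]_x f x).
  apply: eq_measure_integral => A mA _.
  apply: lebesgue_measure_unique => // _ [[a b]] _ <-.
  rewrite /= -[LHS]/(mu `]a, b]%classic) -[RHS]/(k%:E * mu (phi @^-1` `]a, b]%classic)).
  rewrite (_ : phi @^-1` _ = `](a / k)%R, (b / k)%R]%classic); last first.
    by apply/seteqP; split=> x /=; rewrite !in_itv/= /phi ltr_pdivrMr//
      ler_pdivlMr// (mulrC x).
  rewrite !muE ltr_pM2r ?invr_gt0//.
  case: ifP => _; last by rewrite mule0.
  by rewrite -EFinM; congr EFin; field; rewrite gt_eqF.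
rewrite /nu ge0_integral_mscale//=; congr (_ * _).
by rewrite ge0_integral_pushforward.
Qed.

End lebesgue.

Section normal.
Context {d : measure_display} {T : measurableType d} {R : realType}.
Variable P : probability T R.
Local Open Scope ereal_scope.
Let mu : {measure set (measurableTypeR R) -> \bar R} := @lebesgue_measure R.

Lemma measurable_EFin_normal_pdf (m s : R) :
  measurable_fun [set: measurableTypeR R] (fun x => (normal_pdf m s x)%:E).
Proof. by apply/measurable_EFinP; exact: measurable_normal_pdf. Qed.

Lemma ge0_integral_normal (m s : R) (X : {RV P >-> R}) (f : R -> \bar R) :
  normal_rv P m s X -> measurable_fun setT f -> (forall x, 0 <= f x) ->
  \int[P]_w f (X w) = \int[mu]_x (f x * (normal_pdf m s x)%:E).
Proof.
move=> nX mf f0.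
(* normal_prob is a measure on measurableTypeR R, an alias of R with another display *)
pose X' : T -> measurableTypeR R := X.
have mX' : measurable_fun setT X' by exact: (measurable_funP X).
pose X'' : {RV P >-> measurableTypeR R} :=
  HB.pack X' (isMeasurableFun.Build _ _ _ _ X' mX').
transitivity (\int[distribution P X'']_x f x).
  by rewrite ge0_integral_distribution.
apply: ge0_integral_density => //; first exact: measurable_normal_pdf.
exact: normal_pdf_ge0.
Qed.

Lemma normal_mgf (s a b : R) (X : {RV P >-> R}) : (0 < s)%R ->
  normal_rv P 0 s X ->
  \int[P]_w (expR (a * X w + b))%:E = (expR (a ^+ 2 * s ^+ 2 / 2 + b))%:E.
Proof.
move=> s0 nX; have sn0 : s != 0%R by rewrite gt_eqF.
rewrite (ge0_integral_normal (f := fun x => (expR (a * x + b))%:E) nX)//.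
- under eq_integral => x _.
    rewrite (_ : _ * _ = (expR (a ^+ 2 * s ^+ 2 / 2 + b))%:E *
                         (normal_pdf (a * s ^+ 2) s x)%:E).
      over.
    rewrite -!EFinM !normal_pdfE// [in LHS]mulrCA [in RHS]mulrCA /normal_fun -!expRD.
    congr (_ * expR _)%:E; rewrite -[(s ^+ 2 *+ 2)%R]mulr_natr; field.
    exact: sn0.
  rewrite ge0_integralZl//=; last 2 first.
  - exact: measurable_EFin_normal_pdf.
  - by move=> x _; rewrite lee_fin normal_pdf_ge0.
  by rewrite integral_normal_pdf mule1.
- apply/measurable_EFinP; apply: measurableT_comp => //.
  by apply: measurable_funD => //; exact: mulrl_measurable.
Qed.

Lemma ge0_integral_normal_scale (k : R) (X Y : {RV P >-> R}) (f : R -> \bar R) :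
  (0 < k)%R -> normal_rv P 0 1 X -> normal_rv P 0 k Y ->
  measurable_fun setT f -> (forall x, 0 <= f x) ->
  \int[P]_w f (Y w) = \int[P]_w f (k * X w)%R.
Proof.
move=> k0 nX nY mf f0; have kn0 : k != 0%R by rewrite gt_eqF.
rewrite (ge0_integral_normal nY)//.
rewrite (ge0_integral_normal (f := fun x => f (k * x)%R) nX)//; last first.
  by apply: measurableT_comp => //; exact: mulrl_measurable.
rewrite (ge0_integral_dilation k0)//; last 2 first.
- apply: emeasurable_funM => //.
  exact: measurable_EFin_normal_pdf.
- by move=> x; rewrite mule_ge0// lee_fin normal_pdf_ge0.
rewrite -ge0_integralZl//=; last 3 first.
- apply: emeasurable_funM => //.
    by apply: measurableT_comp => //; exact: mulrl_measurable.
  apply: (measurableT_comp (@measurable_EFin_normal_pdf _ _)).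
  exact: mulrl_measurable.
- by move=> x _; rewrite mule_ge0// lee_fin normal_pdf_ge0.
- by rewrite lee_fin ltW.
apply: eq_integral => x _; rewrite muleCA; congr (_ * _).
rewrite -EFinM !normal_pdfE ?oner_eq0// /normal_fun /normal_peak; congr EFin.
rewrite -!mulrnAr sqrtrM ?sqr_ge0// sqrtr_sqr gtr0_norm// expr1n mul1r !subr0.
rewrite invfM !mulrA divff// mul1r; congr (_ * expR _)%R.
- by rewrite div1r.
- by rewrite -[(k *+ 2)%R]mulr_natr; field.
Qed.

End normal.

Section affine.
Context {d : measure_display} {T : measurableType d} {R : realType}.
Variable P : probability T R.

Lemma measurable_affine (a b : R) (X : {RV P >-> R}) :
  measurable_fun setT (fun w => a * X w + b).
Proof.
by apply: measurable_funD => //; apply: measurable_funM.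
Qed.

Definition affine_rv (a b : R) (X : {RV P >-> R}) : {RV P >-> R} :=
  HB.pack (fun w => a * X w + b)
    (isMeasurableFun.Build _ _ _ _ (fun w => a * X w + b) (measurable_affine a b X)).

Lemma affine_rv_algebra (a b : R) (X : {RV P >-> R}) :
  g_sigma_algebra_preimage (affine_rv a b X) `<=` g_sigma_algebra_preimage X.
Proof.
move=> _ [B mB <-]; rewrite setTI.
rewrite -[_ @^-1` B]/(X @^-1` ((fun x => a * x + b) @^-1` B)).
apply: preimage_algebra; rewrite -[_ @^-1` B]setTI.
have : measurable_fun setT (fun x : R => a * x + b) by
  apply: measurable_funD => //; exact: mulrl_measurable.
exact.
Qed.

Lemma mutually_independent_reindex (K : eqType) (F G : K -> set (set T))
    (p : K -> K) : cancel p p -> (forall k, G k `<=` F (p k)) ->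
  mutually_independent P F -> mutually_independent P G.
Proof.
move=> pK GF iF J A uJ GA.
have pJ k : (p k \in map p J) = (k \in J) by rewrite mem_map//; exact: can_inj pK.
have := iF (map p J) (A \o p); rewrite map_inj_uniq; last exact: can_inj pK.
move=> /(_ uJ)/= H.
transitivity (\prod_(k <- J) P (A (p (p k))))%E; last first.
  by apply: eq_bigr => k _; rewrite pK.
rewrite -(big_map p xpredT (fun k => P (A (p k)))) -H.
  congr (P _); apply/seteqP; split=> w Aw k /= kJ.
    by apply: Aw => /=; rewrite -pJ pK.
  by have /= := Aw (p k); rewrite pK pJ; exact.
by move=> k; rewrite -{1}(pK k) pJ => /GA /GF; rewrite pK.
Qed.

End affine.

Lemma within_continuous_drift (R : realType) (f g : R -> R) (D E : set R)
    (th b c : R) : {within D, continuous f} -> continuous g ->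
  (forall u, E u -> D (g u)) ->
  {within E, continuous (fun u => th * (f (g u) - b - c * u))}.
Proof.
move=> /subspace_continuousP cf cg EDg; apply/subspace_continuousP => u Eu.
rewrite /from_subspace.
have idc : v @[v --> within E (nbhs u)] --> u by apply: cvg_within_filter; exact: cvg_id.
have gc : g v @[v --> within E (nbhs u)] --> within D (nbhs (g u)).
  move=> A /= wA.
  have : nbhs u (g @^-1` [set y | D y -> A y]) by apply: cg.
  by rewrite nbhs_simpl /= /within /=; apply: filterS => v + Ev; apply; exact: EDg.
apply: cvgM; first exact: cvg_cst.
apply: cvgB; last first.
  by apply: cvgM; [exact: cvg_cst|exact: idc].
apply: cvgB; last exact: cvg_cst.
exact: cvg_comp gc (cf _ (EDg _ Eu)).
Qed.

Section brownian.
Context {d : measure_display} {T : measurableType d} {R : realType}.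
Variable P : probability T R.
Variables (s : R) (B : R -> {RV P >-> R}).
Hypotheses (s0 : 0 < s) (BM : brownian_motion s B).

Let Bcont w : {within `[0, +oo[, continuous (fun t => B t w)}.
Proof. by case: BM. Qed.

Let Bnormal u t : 0 <= u -> u < t ->
  normal_rv P 0 (s * Num.sqrt (t - u)) (B t \- B u).
Proof. by case: BM => _ _ + _; exact. Qed.

Let Bindep (t : nat -> R) : 0 <= t 0%N -> nondecreasing_seq t ->
  mutually_independent P
    (fun k : nat => g_sigma_algebra_preimage (B (t k.+1) \- B (t k))).
Proof. by case: BM => _ _ _; exact. Qed.

Let step_mgf (sg th c u t : R) : sg ^+ 2 = 1 -> 0 <= u -> u < t ->
  th = c *+ 2 / s ^+ 2 ->
  (\int[P]_w (expR (@affine_rv _ _ _ P (sg * th) (- (th * c * (t - u))) (B t \- B u) w))%:E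
   <= 1)%E.
Proof.
move=> sg2 u0 ut thE.
have tu : 0 < t - u by rewrite subr_gt0.
rewrite (@normal_mgf _ _ _ P (s * Num.sqrt (t - u))) ?mulr_gt0 ?sqrtr_gt0//; last exact: Bnormal.
rewrite !exprMn sg2 mul1r sqr_sqrtr ?(ltW tu)//.
rewrite (_ : _ + _ = 0) ?expR0// thE -mulr_natr; field.
by rewrite gt_eqF.
Qed.

Let dyadic_times (r a : R) n k : R := r + a * (k%:R / (2 ^ n)%:R).

Let dyadic_times_lt r a n k : 0 < a -> dyadic_times r a n k < dyadic_times r a n k.+1.
Proof.
move=> a0; rewrite ltrD2l ltr_pM2l// ltr_pM2r ?ltr_nat//.
Qed.

Let dyadic_times_ge r a n k : 0 < a -> 0 <= r -> 0 <= dyadic_times r a n k.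
Proof. by move=> a0 r0; rewrite addr_ge0// mulr_ge0 ?divr_ge0// ltW. Qed.

Let dyadic_times_step r a n k :
  dyadic_times r a n k.+1 - dyadic_times r a n k = a / (2 ^ n)%:R.
Proof.
by rewrite /dyadic_times -natr1; field; rewrite pnatr_eq0 -lt0n expn_gt0.
Qed.

Lemma brownian_forward_sup_le (r c x : R) : 0 <= r -> 0 < c -> 0 <= x ->
  (P (exceeds (fun u w => B (r + u) w - B r w - c * u)%R `[0%R, +oo[%classic x)
   <= (expR (- (c *+ 2 / s ^+ 2 * x)))%:E)%E.
Proof.
move=> r0 c0 x0; pose th := c *+ 2 / s ^+ 2.
have th0 : 0 < th by rewrite divr_gt0 ?exprn_gt0// mulrn_wgt0.
pose Z u w := th * (B (r + u) w - B r w - c * u).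
rewrite (_ : exceeds _ _ x = exceeds Z `[0, +oo[%classic (th * x)); last first.
  by apply/seteqP; split=> w [u u0 xB]; exists u => //; move: xB; rewrite /Z ltr_pM2l.
apply: exceeds_halfline_le.
- by rewrite mulr_ge0// ltW.
- move=> w; apply: (@within_continuous_drift _ (B^~ w) _ `[0, +oo[%classic) => //.
    by move=> u; apply: cvgD; [exact: cvg_cst|exact: cvg_id].
  by move=> u /=; rewrite !in_itv/= !andbT => u0; exact: addr_ge0.
- by move=> u; apply: measurable_funM => //; apply: measurable_funB => //;
    exact: measurable_funB.
move=> a a0 n; pose t := dyadic_times r a n.
exists (fun k => @affine_rv _ _ _ P (1 * th) (- (th * c * (t k.+1 - t k))) (B (t k.+1) \- B (t k))).
split.
- apply: (@mutually_independent_reindex _ _ _ P _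
    (fun k => g_sigma_algebra_preimage (B (t k.+1) \- B (t k))) _ id) => //.
    by move=> k; exact: affine_rv_algebra.
  apply: Bindep; first exact: dyadic_times_ge.
  by apply/nondecreasing_seqP => k; apply/ltW/dyadic_times_lt.
- move=> k; apply: step_mgf => //; first by rewrite expr1n.
    exact: dyadic_times_ge.
  exact: dyadic_times_lt.
- move=> k w _; elim: k => [|k IH].
    by rewrite big_ord0 /Z !(mul0r, mulr0) addr0 !subrr mulr0.
  rewrite big_ord_recr/= -IH /Z /t dyadic_times_step /= /dyadic_times -natr1.
  by field; rewrite pnatr_eq0 -lt0n expn_gt0.
Qed.

Lemma brownian_backward_sup_le (r c x : R) : 0 < r -> 0 < c -> 0 <= x ->
  (P (exceeds (fun u w => B (r - u) w - B r w - c * u)%R `[0%R, r]%classic x)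
   <= (expR (- (c *+ 2 / s ^+ 2 * x)))%:E)%E.
Proof.
move=> r0 c0 x0; pose th := c *+ 2 / s ^+ 2.
have th0 : 0 < th by rewrite divr_gt0 ?exprn_gt0// mulrn_wgt0.
pose Z u w := th * (B (r - u) w - B r w - c * u).
rewrite (_ : exceeds _ _ x = exceeds Z `[0, r]%classic (th * x)); last first.
  by apply/seteqP; split=> w [u u0 xB]; exists u => //; move: xB; rewrite /Z ltr_pM2l.
apply: exceeds_itv_le => //.
- by rewrite mulr_ge0// ltW.
- move=> w; apply: (@within_continuous_drift _ (B^~ w) _ `[0, +oo[%classic) => //.
    by move=> u; apply: cvgB; [exact: cvg_cst|exact: cvg_id].
  by move=> u /=; rewrite !in_itv/= andbT subr_ge0 => /andP[].
move=> n; pose t := dyadic_times 0 r n; pose N := (2 ^ n)%N.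
pose p k := if (k < N)%N then (N - k.+1)%N else k.
have pK : cancel p p.
  move=> k; rewrite /p; case: (ltnP k N) => kN; last by rewrite ltnNge kN.
  by rewrite ltn_subrL/= (leq_ltn_trans _ kN)//= subnSK// subKn// ltnW.
exists (fun k => @affine_rv _ _ _ P (-1 * th) (- (th * c * (t (p k).+1 - t (p k))))
  (B (t (p k).+1) \- B (t (p k)))).
split.
- apply: (@mutually_independent_reindex _ _ _ P _
    (fun k => g_sigma_algebra_preimage (B (t k.+1) \- B (t k))) _ p) => //.
    by move=> k; exact: affine_rv_algebra.
  apply: Bindep; first exact: dyadic_times_ge.
  by apply/nondecreasing_seqP => k; apply/ltW/dyadic_times_lt.
- move=> k; apply: step_mgf => //; first by rewrite sqrrN expr1n.
    exact: dyadic_times_ge.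
  exact: dyadic_times_lt.
- move=> k w; elim: k => [|k IH] kN.
    by rewrite big_ord0 /Z !(mul0r, mulr0) !subr0 subrr mulr0.
  rewrite big_ord_recr/= -(IH (ltnW kN)) /Z /t dyadic_times_step /= /p kN.
  have tE j : (j <= N)%N -> r - r * (j%:R / N%:R) = dyadic_times 0 r n (N - j).
    move=> jN; rewrite /dyadic_times natrB// -/N; field.
    by rewrite pnatr_eq0 -lt0n expn_gt0.
  rewrite !tE// 1?ltnW// subnSK// -natr1 -/N.
  by field; rewrite pnatr_eq0 -lt0n expn_gt0.
Qed.

End brownian.

Section tail.
Context {d : measure_display} {T : measurableType d} {R : realType}.
Variable P : probability T R.

Lemma integral_le_exp_tail (f : T -> R) (a th : R) :
  measurable_fun setT f -> (forall w, 0 <= f w) -> 0 < th -> 0 <= a ->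
  (forall t, 0 <= t -> (P [set w | t < f w]%R <= (a * expR (- (th * t)))%:E)%E) ->
  (\int[P]_w (f w)%:E <= (a / th)%:E)%E.
Proof.
move=> mf f0 th0 a0 tail.
pose X : {RV P >-> R} := HB.pack f (isMeasurableFun.Build _ _ _ _ f mf).
have := ge0_expectation_ccdf (X := X) f0; rewrite unlock => ->.
have mexp : measurable_fun setT (EFin \o exponential_pdf th).
  by apply/measurable_EFinP; exact: measurable_exponential_pdf.
have pdf0 x : 0 <= exponential_pdf th x by apply: exponential_pdf_ge0; exact: ltW.
apply: (@le_trans _ _ (\int[lebesgue_measure]_(r in `[0%R, +oo[)
   ((a / th)%:E * (exponential_pdf th r)%:E))%E).
  apply: ge0_le_integral => //.
  - by apply: measurable_funTS; exact: ccdf_measurable.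
  - by apply: measurable_funTS; apply: emeasurable_funM.
  - move=> t; rewrite /= in_itv/= andbT => t0.
    rewrite /exponential_pdf patchE mem_set /=; last by rewrite in_itv/= t0.
    rewrite -EFinM mulrA divfK ?gt_eqF// mulNr; apply: le_trans (tail t t0).
    rewrite le_eqVlt; apply/orP; left; apply/eqP; congr (P _).
    by apply/seteqP; split=> w; rewrite /= in_itv/= andbT.
rewrite ge0_integralZl//=.
- rewrite -[leRHS]mule1 lee_wpmul2l ?lee_fin ?divr_ge0 ?(ltW th0)//.
  rewrite -(integral_exponential_pdf th0).
  by apply: ge0_subset_integral => // x _; rewrite lee_fin.
- exact: measurable_funTS.
- by move=> x _; rewrite lee_fin.
- by rewrite lee_fin divr_ge0// ltW.
Qed.

End tail.

Section queue.
Context {d : measure_display} {T : measurableType d} {R : realType}.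
Variable P : probability T R.
Variables (sigma sigmaA : R) (W : nat -> R -> {RV P >-> R}) (WA : R -> {RV P >-> R}).
Hypotheses (sigma0 : 0 < sigma) (sigmaA0 : 0 < sigmaA).
Hypotheses (BW : forall i, brownian_motion sigma (W i)).
Hypothesis BA : brownian_motion sigmaA WA.

Let Q := max_queue W WA.

Definition netput i s w : R := W i s w + WA s w - s.

Lemma netput0 i w : netput i 0 w = 0.
Proof.
rewrite /netput; case: (BW i) => -> _ _ _; case: BA => -> _ _ _.
by rewrite addr0 subr0.
Qed.

Lemma continuous_netput i w : {within `[0, +oo[, continuous (netput i ^~ w)}.
Proof.
have [_ /(_ w)/subspace_continuousP cW _ _] := BW i.
have [_ /(_ w)/subspace_continuousP cA _ _] := BA.
apply/subspace_continuousP => u u0; apply: cvgB; first by apply: cvgD; [exact: cW|exact: cA].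
by apply: cvg_within_filter; exact: cvg_id.
Qed.

Lemma measurable_netput i s : measurable_fun setT (netput i s).
Proof. by apply: measurable_funB => //; exact: measurable_funD. Qed.

Definition bounded_netput i w := exists n : nat, ~ exceeds (netput i) `[0, +oo[%classic n%:R w.

Lemma netput_le i w s : bounded_netput i w -> 0 < s -> netput i s w <= Q i w.
Proof.
move=> [n nbn] s0; apply: ub_le_sup; last by exists s.
exists n%:R => _ [u u0 <-]; rewrite leNgt; apply/negP => nu.
by apply: nbn; exists u => //=; rewrite in_itv/= andbT ltW.
Qed.

Lemma max_queue_gt i w y : y < Q i w -> exists2 s : R, 0 < s & y < netput i s w.
Proof.
by move=> /sup_gt[|_ [s s0 <-] ys]; [exists (netput i 1 w); exists 1 => //=|exists s].
Qed.

Lemma exceeds_gt0 i w y : exceeds (netput i) `[0, +oo[%classic y w ->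
  exists2 s : R, 0 < s & y < netput i s w.
Proof.
move=> [u]; rewrite /= in_itv/= andbT le_eqVlt => /predU1P[<-|u0 yu]; last by exists u.
rewrite netput0 => y0.
have [||e e0 he] :=
  @within_continuous_gt _ (netput i ^~ w) `[0, +oo[%classic 0 y (@continuous_netput i w).
- by rewrite /= in_itv/= lexx.
- by rewrite netput0.
- exists (e / 2); first exact: divr_gt0.
  apply: he; first by rewrite /= in_itv/= andbT ltW// divr_gt0.
  by rewrite sub0r normrN gtr0_norm ?divr_gt0// ltr_pdivrMr// ltr_pMr// ltr1n.
Qed.

Lemma unbounded_max_queue i w : ~ bounded_netput i w -> Q i w = 0.
Proof.
move=> nb; apply: sup_out => -[_ [x ubx]]; apply: nb.
exists (Num.truncn x).+1 => /exceeds_gt0[s s0] xs.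
have /= := ubx (netput i s w); rewrite leNgt => /(_ _)/negP.
by apply; [exists s|apply: lt_trans xs; exact: truncnS_gt].
Qed.

Lemma max_queue_ge0 i w : 0 <= Q i w.
Proof.
have [b|/unbounded_max_queue ->//] := pselect (bounded_netput i w).
rewrite leNgt; apply/negP => Q0.
have [|s s0] := @exceeds_gt0 i w (Q i w).
  by exists 0; rewrite ?netput0//= in_itv/= lexx.
by rewrite ltNge netput_le.
Qed.

Lemma max_queue_gtE i w y : 0 <= y ->
  y < Q i w <-> bounded_netput i w /\ exceeds (netput i) `[0, +oo[%classic y w.
Proof.
move=> y0; split.
  move=> yQ; split.
    by apply: contrapT => /unbounded_max_queue Q0; move: yQ; rewrite Q0 ltNge y0.
  by have [s s0 ys] := max_queue_gt yQ; exists s => //=; rewrite in_itv/= andbT ltW.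
by move=> [b /exceeds_gt0[s s0]] ys; apply: lt_le_trans ys _; exact: netput_le.
Qed.

Lemma measurable_exceeds_netput i y :
  measurable (exceeds (netput i) `[0, +oo[%classic y).
Proof.
apply: measurable_exceeds_halfline; first exact: continuous_netput.
exact: measurable_netput.
Qed.

Lemma measurable_bounded_netput i : measurable [set w | bounded_netput i w].
Proof.
rewrite (_ : mkset _ = \bigcup_n ~` exceeds (netput i) `[0, +oo[%classic n%:R).
  by apply: bigcupT_measurable => n; apply: measurableC; exact: measurable_exceeds_netput.
by apply/seteqP; split=> w [n]; [move=> nb; exists n|move=> _ nb; exists n].
Qed.

Lemma measurable_max_queue i : measurable_fun setT (Q i).
Proof.
move=> mD; apply: (measurability _ (RGenOInfty.measurableE R)) => //.
move=> /= _ [_ [y ->] <-]; rewrite setTI.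
have [y0|y0] := leP 0 y.
  rewrite (_ : _ @^-1` _ = [set w | bounded_netput i w] `&`
      exceeds (netput i) `[0, +oo[%classic y).
    by apply: measurableI; [exact: measurable_bounded_netput|exact: measurable_exceeds_netput].
  by apply/seteqP; split=> w; rewrite /= in_itv/= andbT => /(max_queue_gtE _ _ y0).
rewrite (_ : _ @^-1` _ = setT) //; apply/seteqP; split=> w //= _.
by rewrite in_itv/= andbT (lt_le_trans y0)// max_queue_ge0.
Qed.

Lemma drift_sup_le (s c x : R) (B : R -> {RV P >-> R}) : 0 < s ->
  brownian_motion s B -> 0 < c -> 0 <= x ->
  (P (exceeds (fun u w => B u w - c * u)%R `[0%R, +oo[%classic x)
   <= (expR (- (c *+ 2 / s ^+ 2 * x)))%:E)%E.
Proof.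
move=> s0 BB c0 x0; have := brownian_forward_sup_le s0 BB (lexx 0) c0 x0.
congr (P (exceeds _ _ _) <= _)%E; apply/funext => u; apply/funext => w.
by case: BB => -> _ _ _; rewrite add0r subr0.
Qed.

Lemma measurable_drift (s c x : R) (B : R -> {RV P >-> R}) :
  brownian_motion s B ->
  measurable (exceeds (fun u w => B u w - c * u) `[0, +oo[%classic x).
Proof.
move=> [_ cB _ _]; apply: measurable_exceeds_halfline; last first.
  by move=> u; apply: measurable_funB.
move=> w; apply/subspace_continuousP => u u0.
move/subspace_continuousP: (cB w) => {}cB.
apply: cvgB; first exact: cB.
by apply: cvgM; [exact: cvg_cst|apply: cvg_within_filter; exact: cvg_id].
Qed.

Lemma exceeds_netput_le i : exists2 th : R, 0 < th & forall x, 0 <= x ->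
  (P (exceeds (netput i) `[0%R, +oo[%classic x) <= (2 * expR (- (th * x)))%:E)%E.
Proof.
have h0 : (0 : R) < 1 / 2 by [].
pose th1 := (1 / 2) *+ 2 / sigma ^+ 2 / 2 : R.
pose th2 := (1 / 2) *+ 2 / sigmaA ^+ 2 / 2 : R.
have th10 : 0 < th1 by rewrite divr_gt0// divr_gt0 ?exprn_gt0// mulrn_wgt0.
have th20 : 0 < th2 by rewrite divr_gt0// divr_gt0 ?exprn_gt0// mulrn_wgt0.
exists (Num.min th1 th2); first by rewrite lt_min th10.
move=> x x0; have x20 : 0 <= x / 2 by rewrite divr_ge0.
pose E1 := exceeds (fun u w => W i u w - (1 / 2) * u) `[0, +oo[%classic (x / 2).
pose E2 := exceeds (fun u w => WA u w - (1 / 2) * u) `[0, +oo[%classic (x / 2).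
have mE1 : measurable E1 := measurable_drift (1 / 2) (x / 2) (BW i).
have mE2 : measurable E2 := measurable_drift (1 / 2) (x / 2) BA.
apply: (@le_trans _ _ (P (E1 `|` E2))).
  apply: le_measure; rewrite ?inE.
  - exact: measurable_exceeds_netput.
  - exact: measurableU.
  move=> w [u u0 xu]; have [E1u|E1u] := ltP (x / 2) (W i u w - (1 / 2) * u).
    by left; exists u.
  right; exists u => //; move: xu E1u; rewrite /netput; lra.
apply: le_trans (measureU2 _ mE1 mE2) _; rewrite mulr_natl mulr2n EFinD.
apply: leeD.
  apply: le_trans (drift_sup_le sigma0 (BW i) h0 x20) _.
  by rewrite lee_fin ler_expR lerN2 mulrCA [leRHS]mulrC ler_wpM2r// ge_min lexx.
apply: le_trans (drift_sup_le sigmaA0 BA h0 x20) _.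
by rewrite lee_fin ler_expR lerN2 mulrCA [leRHS]mulrC ler_wpM2r// ge_min lexx orbT.
Qed.

Lemma ae_bounded_netput i : {ae P, forall w, bounded_netput i w}.
Proof.
have [th th0 le_th] := exceeds_netput_le i.
exists (~` [set w | bounded_netput i w]); split => //.
  exact/measurableC/measurable_bounded_netput.
apply/eqP; rewrite eq_le measure_ge0 andbT; apply/lee_addgt0Pr => e e0.
rewrite add0e.
have [n ne] : exists n : nat, 2 * expR (- (th * n%:R)) <= e.
  exists (Num.truncn (2 / e / th)).+1; rewrite expRN ler_pdivrMr ?expR_gt0//.
  rewrite -ler_pdivrMl// [leLHS]mulrC; apply: le_trans (expR_ge1Dx _).
  rewrite -[leLHS]add0r lerD// -ler_pdivrMl// [leLHS]mulrC.
  exact/ltW/truncnS_gt.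
apply: le_trans (le_trans (le_th n%:R (ler0n _ _)) _); last by rewrite lee_fin.
apply: le_measure; rewrite ?inE.
- exact/measurableC/measurable_bounded_netput.
- exact: measurable_exceeds_netput.
by move=> w nb; apply: contrapT => nE; apply: nb; exists n.
Qed.

Lemma integrable_max_queue i : P.-integrable setT (EFin \o Q i).
Proof.
have [th th0 le_th] := exceeds_netput_le i.
apply/integrableP; split; first exact/measurable_EFinP/measurable_max_queue.
under eq_integral do rewrite /= ger0_norm ?max_queue_ge0//.
apply: (@le_lt_trans _ _ (2 / th)%:E); last exact: ltry.
apply: integral_le_exp_tail => //.
- exact: measurable_max_queue.
- by move=> w; exact: max_queue_ge0.
move=> t t0; apply: le_trans (le_th t t0); apply: le_measure; rewrite ?inE.
- rewrite (_ : mkset _ = Q i @^-1` `]t, +oo[).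
    by rewrite -[_ @^-1` _]setTI; exact: measurable_max_queue.
  by apply/seteqP; split=> w; rewrite /= in_itv/= andbT.
- exact: measurable_exceeds_netput.
- by move=> w /= /(max_queue_gtE _ _ t0)[].
Qed.

End queue.

Section queue_upper.
Context {d : measure_display} {T : measurableType d} {R : realType}.
Variable P : probability T R.
Variables (sigma sigmaA : R) (W : nat -> R -> {RV P >-> R}) (WA : R -> {RV P >-> R}).
Hypotheses (sigma0 : 0 < sigma) (sigmaA0 : 0 < sigmaA).
Hypotheses (BW : forall i, brownian_motion sigma (W i)).
Hypothesis BA : brownian_motion sigmaA WA.

Let Q := max_queue W WA.

Lemma max_of_gt (V : nat -> T -> R) N w y : (0 < N)%N -> y < max_of V N w ->
  exists2 j, (j < N)%N & y < V j w.
Proof.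
move=> N0; apply: contraPP => noj; apply/negP; rewrite -leNgt.
have H j : (j < N)%N -> V j w <= y.
  by move=> jN; rewrite leNgt; apply/negP => yV; apply: noj; exists j.
by apply: bigmax_le => [|j _]; exact: H.
Qed.

Lemma max_of_ge (V : nat -> T -> R) N w j : (j < N)%N -> V j w <= max_of V N w.
Proof. by move=> jN; exact: (le_bigmax _ (fun i : 'I_N => V i w) (Ordinal jN)). Qed.

Lemma measurable_max_of (V : nat -> T -> R) N :
  (forall j, measurable_fun setT (V j)) -> measurable_fun setT (max_of V N).
Proof.
move=> mV; rewrite /max_of; elim: (index_enum _) => [|j r IH].
  by rewrite (_ : (fun _ => _) = V 0%N)//; apply/funext => w; rewrite big_nil.
rewrite (_ : (fun _ => _) =
    (fun w => Num.max (V j w) (\big[Num.max/V 0%N w]_(i <- r) V i w))).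
  exact: measurable_maxr.
by apply/funext => w; rewrite big_cons.
Qed.

Lemma continuous_drift_from (s r c : R) (B : R -> {RV P >-> R}) (D : set R)
    (g : R -> R) : brownian_motion s B -> continuous g ->
  (forall u, D u -> 0 <= g u) ->
  forall w, {within D, continuous (fun u => B (g u) w - B r w - c * u)}.
Proof.
move=> [_ cB _ _] cg Dg w.
have := @within_continuous_drift _ (B^~ w) g `[0, +oo[%classic D 1 (B r w) c (cB w) cg.
under [X in {within _, continuous X}]eq_fun do rewrite mul1r.
by apply => u Du; rewrite /= in_itv/= andbT; exact: Dg.
Qed.

Section fixed.
Variables (N : nat) (delta : R).
Hypotheses (N2 : (2 <= N)%N) (delta0 : 0 < delta) (delta_half : delta <= 1 / 2).

Let L : R := ln N%:R.
Let st : R := sigma ^+ 2 * L / 2.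
Let th : R := delta * 2 / (sigma ^+ 2 + sigmaA ^+ 2).

Let N0 : 0 < N%:R :> R. Proof. by rewrite ltr0n (leq_trans _ N2). Qed.
Let L0 : 0 < L. Proof. by rewrite ln_gt0// ltr1n. Qed.
Let st0 : 0 < st. Proof. by rewrite divr_gt0// mulr_gt0// exprn_gt0. Qed.
Let s20 : 0 < sigma ^+ 2. Proof. by rewrite exprn_gt0. Qed.
Let sA20 : 0 < sigmaA ^+ 2. Proof. by rewrite exprn_gt0. Qed.
Let th0 : 0 < th. Proof. by rewrite divr_gt0 ?mulr_gt0// addr_gt0. Qed.

Let E1 t := exceeds (fun u w => WA (st + u) w - WA st w - delta * u) `[0, +oo[%classic t.
Let E2 t := exceeds (fun u w => WA (st - u) w - WA st w - delta * u) `[0, st]%classic t.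
Let G1 c t j := exceeds (fun u w => W j u w - c * u) `[0, +oo[%classic (st / c + t).
Let G c t := \big[setU/set0]_(j < N) G1 c t j.

Let mE1 t : measurable (E1 t).
Proof.
apply: measurable_exceeds_halfline => [w|u].
  apply: (@continuous_drift_from sigmaA st delta WA _ (fun u => st + u) BA).
    by move=> u; apply: cvgD; [exact: cvg_cst|exact: cvg_id].
  by move=> u; rewrite /= in_itv/= andbT => u0; rewrite addr_ge0// ltW.
by apply: measurable_funB => //; exact: measurable_funB.
Qed.

Let mE2 t : measurable (E2 t).
Proof.
apply: measurable_exceeds_itv => // [w|u].
  apply: (@continuous_drift_from sigmaA st delta WA _ (fun u => st - u) BA).
    by move=> u; apply: cvgB; [exact: cvg_cst|exact: cvg_id].
  by move=> u; rewrite /= in_itv/= => /andP[_]; rewrite subr_ge0.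
by apply: measurable_funB => //; exact: measurable_funB.
Qed.

Let mG c t : measurable (G c t).
Proof. by apply: bigsetU_measurable => j _; exact: measurable_drift (BW j). Qed.

Let th_leA : th <= delta *+ 2 / sigmaA ^+ 2.
Proof.
rewrite /th mulr_natr ler_pM2l ?mulrn_wgt0// lef_pV2 ?posrE ?addr_gt0//.
by rewrite lerDr ltW.
Qed.

Let E1_le t : 0 <= t -> (P (E1 t) <= (expR (- (th * t)))%:E)%E.
Proof.
move=> t0; apply: le_trans (brownian_forward_sup_le sigmaA0 BA (ltW st0) delta0 t0) _.
by rewrite lee_fin ler_expR lerN2 ler_wpM2r.
Qed.

Let E2_le t : 0 <= t -> (P (E2 t) <= (expR (- (th * t)))%:E)%E.
Proof.
move=> t0; apply: le_trans (brownian_backward_sup_le sigmaA0 BA st0 delta0 t0) _.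
by rewrite lee_fin ler_expR lerN2 ler_wpM2r.
Qed.

(* The union bound over the N queues is absorbed by the factor
   expR (- ln N) produced by the shift st / c. *)
Let G_le c t : 1 / 2 <= c -> 0 <= t -> (P (G c t) <= (expR (- (th * t)))%:E)%E.
Proof.
move=> c_half t0; have c0 : 0 < c by apply: lt_le_trans c_half.
have thc : th <= c *+ 2 / sigma ^+ 2.
  rewrite /th mulr_natr; apply: (@le_trans _ _ (c *+ 2 / (sigma ^+ 2 + sigmaA ^+ 2))).
    apply: ler_wpM2r; first by rewrite invr_ge0 addr_ge0// ltW.
    by rewrite lerMn2r/= (le_trans delta_half).
  apply: ler_wpM2l; first by rewrite mulrn_wge0// ltW.
  by rewrite lef_pV2 ?posrE ?addr_gt0// lerDl ltW.
have mE j : measurable (G1 c t j).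
  exact: measurable_drift (BW j).
apply: le_trans (Boole_inequality P (fun j _ => mE j)) _.
have NL : N%:R^-1 = expR (- L) by rewrite expRN lnK// posrE.
have stc0 : 0 <= st / c + t by rewrite addr_ge0// divr_ge0// ltW.
apply: (@le_trans _ _ (\sum_(j < N) (N%:R^-1 * expR (- (th * t)))%:E)%E).
  apply: lee_sum => j _; apply: le_trans (drift_sup_le sigma0 (BW j) c0 stc0) _.
  rewrite lee_fin NL -expRD ler_expR mulrDr opprD.
  rewrite lerD ?lerN2 ?ler_wpM2r//.
  by rewrite -/L /st -mulr_natr [leRHS](_ : _ = L)//; field; rewrite !gt_eqF.
rewrite sumEFin big_const_ord iter_addr_0 lee_fin -[leLHS]mulr_natl mulrA mulfV ?mul1r//.
by rewrite gt_eqF.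
Qed.

Lemma max_queue_upper_tail t : 0 <= t ->
  (P [set w | 2 * st * delta ^+ 2 + 2 * t < max_of Q N w - (st + WA st w)]%R
   <= (4 * expR (- (th * t)))%:E)%E.
Proof.
move=> t0.
have d1 : 0 < 1 - delta by move: delta_half; lra.
have d2 : 0 < 1 + delta by exact: addr_gt0.
apply: (@le_trans _ _ (P ((E1 t `|` G (1 - delta) t) `|` (E2 t `|` G (1 + delta) t)))).
  apply: le_measure; rewrite ?inE.
  - rewrite (_ : mkset _ = (max_of Q N \- (cst st \+ WA st))@^-1`
        `]2 * st * delta ^+ 2 + 2 * t, +oo[).
      rewrite -[_ @^-1` _]setTI; apply: measurable_funB => //.
      by apply: measurable_max_of => j; exact: (measurable_max_queue BW BA).
    by apply/seteqP; split=> w; rewrite /= in_itv/= andbT.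
  - by apply: measurableU; apply: measurableU.
  move=> w /=; rewrite ltrBrDr => /max_of_gt[|j jN]; first exact: leq_trans N2.
  move=> /max_queue_gt[s s0]; rewrite /netput => H.
  apply: contrapT => nE.
  have sle : s <= st \/ st <= s by case: (leP s st) => ?; [left|right; exact: ltW].
  have GE c : ~ G c t w -> W j s w <= c * s + (st / c + t).
    move=> nG; rewrite leNgt; apply/negP => Ws; apply: nG; rewrite /G -(bigcup_mkord N (G1 c t)).
    by exists j => //; exists s; rewrite /= ?in_itv/= ?andbT ?ltW// ltrBrDl.
  case: sle => sle.
    have : WA s w - WA st w <= delta * (st - s) + t.
      rewrite leNgt; apply/negP => H2; apply: nE; right; left.
      exists (st - s); first by rewrite /= in_itv/= subr_ge0 sle gerBl ltW.
      by rewrite subKr ltrBrDl.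
    have /GE : ~ G (1 + delta) t w by move=> ?; apply: nE; right; right.
    have : st / (1 + delta) + delta * st <= st + 2 * st * delta ^+ 2.
      rewrite -subr_ge0.
      rewrite [leRHS](_ : _ = st * delta ^+ 2 * (1 + 2 * delta) / (1 + delta)).
        apply: divr_ge0; last exact: ltW.
        apply: mulr_ge0; last by move: delta0; lra.
        by apply: mulr_ge0; [exact: ltW|exact: exprn_ge0 (ltW delta0)].
      by field; rewrite gt_eqF.
    move: H; lra.
  have : WA s w - WA st w <= delta * (s - st) + t.
    rewrite leNgt; apply/negP => H2; apply: nE; left; left.
    exists (s - st); first by rewrite /= in_itv/= subr_ge0 sle.
    by rewrite (addrC st) subrK ltrBrDl.
  have /GE : ~ G (1 - delta) t w by move=> ?; apply: nE; left; right.
  have : st / (1 - delta) - delta * st <= st + 2 * st * delta ^+ 2.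
    rewrite -subr_ge0.
    rewrite [leRHS](_ : _ = st * delta ^+ 2 * (1 - 2 * delta) / (1 - delta)).
      apply: divr_ge0; last exact: ltW.
      apply: mulr_ge0; last by move: delta_half; lra.
      by apply: mulr_ge0; [exact: ltW|exact: exprn_ge0 (ltW delta0)].
    by field; rewrite gt_eqF.
  move: H; lra.
rewrite (_ : 4 * expR _ = (expR (- (th * t)) + expR (- (th * t))) +
  (expR (- (th * t)) + expR (- (th * t)))); last by ring.
rewrite !EFinD.
have h1 : 1 / 2 <= 1 - delta by move: delta_half; lra.
have h2 : 1 / 2 <= 1 + delta by move: delta0; lra.
apply: le_trans (measureU2 _ _ _) _; [exact: measurableU..|].
by apply: leeD; (apply: le_trans (measureU2 _ _ _) _; [by []..|]);
  apply: leeD; rewrite ?E1_le ?E2_le ?G_le.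
Qed.

Lemma max_queue_upper :
  (\int[P]_w (Num.max (max_of Q N w - (st + WA st w)) 0)%:E
   <= (2 * st * delta ^+ 2 + 8 / th)%:E)%E.
Proof.
pose K := 2 * st * delta ^+ 2.
pose M w := max_of Q N w - (st + WA st w).
have mM : measurable_fun setT M.
  apply: measurable_funB => //; last exact: measurable_funD.
  apply: measurable_max_of => j; exact: (measurable_max_queue BW BA).
have K0 : 0 <= K by rewrite mulr_ge0 ?exprn_ge0 ?mulr_ge0// ltW.
have mf : measurable_fun setT (fun w => Num.max (M w - K) 0).
  by apply: measurable_maxr => //; exact: measurable_funB.
apply: (@le_trans _ _ (\int[P]_w (K%:E + (Num.max (M w - K) 0)%:E))%E).
  apply: ge0_le_integral => //=.
  - by move=> w _; rewrite lee_fin le_max lexx orbT.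
  - by apply/measurable_EFinP; apply: measurable_maxr.
  - by apply/measurable_EFinP; apply: measurable_funD.
  - move=> w _; rewrite -EFinD lee_fin -/(M w) ge_max addr_ge0 ?andbT//.
      by rewrite -lerBlDl le_max lexx.
    by rewrite le_max lexx orbT.
rewrite ge0_integralD//=; last 2 first.
- by move=> w _; rewrite lee_fin le_max lexx orbT.
- exact/measurable_EFinP.
rewrite integral_cst// EFinD; apply: leeD.
  rewrite -[leRHS]mule1 lee_wpmul2l ?lee_fin// probability_le1//.
rewrite (_ : 8 / th = 4 / (th / 2)); last by field; rewrite gt_eqF.
apply: integral_le_exp_tail => //.
- by move=> w; rewrite le_max lexx orbT.
- exact: divr_gt0.
move=> t t0; have t20 : 0 <= t / 2 by rewrite divr_ge0.
rewrite (_ : th / 2 * t = th * (t / 2)); last by ring.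
apply: le_trans (max_queue_upper_tail t20).
rewrite le_eqVlt; apply/orP; left; apply/eqP; congr (P _).
have tE : 2 * (t / 2) = t by rewrite mulrCA mulfV ?mulr1.
have E w : (t < Num.max (M w - K) 0) = (K + t < M w).
  by rewrite lt_max ltrBrDl [t < 0]ltNge t0 orbF.
by apply/seteqP; split=> w /=; rewrite tE E.
Qed.

End fixed.
End queue_upper.

Section gaussian.
Context {d : measure_display} {T : measurableType d} {R : realType}.
Variable P : probability T R.

Definition gauss_const : R := expR (-1) / (2 * Num.sqrt (pi *+ 2)).

Lemma gauss_const_gt0 : 0 < gauss_const.
Proof. by rewrite divr_gt0 ?expR_gt0// mulr_gt0// sqrtr_gt0 mulrn_wgt0// pi_gt0. Qed.

Lemma normal_tail_ge (tau a eps : R) (X : {RV P >-> R}) :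
  0 < tau -> 0 < eps -> eps <= 1 -> eps <= a -> normal_rv P 0 tau X ->
  ((gauss_const * eps * expR (- (a ^+ 2 / 2) + a * eps / 2))%:E
   <= P (X @^-1` `](tau * (a - eps))%R, +oo[))%E.
Proof.
move=> tau0 eps0 eps1 epsa nX; have tn0 : tau != 0 by rewrite gt_eqF.
have -> : P (X @^-1` `]tau * (a - eps), +oo[) =
    normal_prob 0 tau `]tau * (a - eps), +oo[%classic.
  by apply: nX; exact: measurable_itv.
pose I := `](tau * (a - eps)), (tau * (a - eps / 2))]%classic : set (measurableTypeR R).
have mI : measurable I by exact: measurable_itv.
pose c := normal_peak tau * expR (- (a - eps / 2) ^+ 2 / 2).
apply: (@le_trans _ _ (\int[lebesgue_measure]_(x in I) c%:E)%E); last first.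
  apply: (@le_trans _ _ (\int[lebesgue_measure]_(x in I) (normal_pdf 0 tau x)%:E)%E).
    apply: ge0_le_integral => //=.
    - by move=> x _; rewrite lee_fin mulr_ge0 ?normal_peak_ge0// expR_ge0.
    - by apply: measurable_funTS; exact: measurable_EFin_normal_pdf.
    - move=> x; rewrite /I /= in_itv/= => /andP[xl xu].
      rewrite lee_fin normal_pdfE// /c ler_wpM2l ?normal_peak_ge0//.
      rewrite /normal_fun ler_expR subr0 !mulNr lerN2.
      rewrite -mulr_natr invfM mulrA ler_wpM2r ?invr_ge0//.
      rewrite ler_pdivrMr ?exprn_gt0// mulrC -exprMn ler_sqr ?nnegrE//.
        by apply: ltW; apply: le_lt_trans xl; rewrite mulr_ge0 ?(ltW tau0)// subr_ge0.
      rewrite mulr_ge0 ?(ltW tau0)// subr_ge0 (le_trans _ epsa)//.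
      by rewrite ler_pdivrMr// ler_pMr// ler1n.
  apply: ge0_subset_integral => //=.
  - by apply: measurable_funTS; exact: measurable_EFin_normal_pdf.
  - by move=> x _; rewrite lee_fin normal_pdf_ge0.
  - by move=> x; rewrite /I /= !in_itv/= andbT => /andP[].
rewrite integral_cst//= /I lebesgue_measure_itv/= lte_fin ltr_pM2l//.
rewrite ltrD2l ltrN2 ltr_pdivrMr// ltr_pMr// ltr1n -EFinD -EFinM lee_fin.
rewrite (_ : tau * (a - eps / 2) - _ = tau * (eps / 2)); last by field.
rewrite /c /normal_peak -mulrnAr sqrtrM ?sqr_ge0// sqrtr_sqr gtr0_norm//.
set E := - (a ^+ 2 / 2) + a * eps / 2.
rewrite (_ : - (a - eps / 2) ^+ 2 / 2 = E - eps ^+ 2 / 8); last by rewrite /E; field.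
rewrite /gauss_const [in leRHS]expRD.
set s := Num.sqrt _; have s0 : 0 < s by rewrite sqrtr_gt0 mulrn_wgt0// pi_gt0.
set e := expR E.
rewrite [leRHS](_ : _ = expR (- (eps ^+ 2 / 8)) / (2 * s) * eps * e); last first.
  by field; rewrite tn0 gt_eqF.
rewrite ler_wpM2r ?expR_ge0// ler_wpM2r ?(ltW eps0)// ler_wpM2r//.
  by rewrite invr_ge0 mulr_ge0// ltW.
rewrite ler_expR lerN2 ler_pdivrMr// mul1r (@le_trans _ _ 1)// ?ler1n//.
by rewrite expr_le1// ltW.
Qed.

Lemma normal_second_moment (tau : R) (X : {RV P >-> R}) :
  0 < tau -> normal_rv P 0 tau X ->
  (\int[P]_w ((X w) ^+ 2)%:E <= (4 * expR (1 / 2) * tau ^+ 2)%:E)%E.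
Proof.
move=> tau0 nX; have tn0 : tau != 0 by rewrite gt_eqF.
pose e (b : R) w := expR (b / tau * X w + 0).
have me b : measurable_fun setT (e b).
  by apply: measurableT_comp => //; exact: measurable_affine.
have Ee b : b ^+ 2 = 1 -> (\int[P]_w (e b w)%:E = (expR (1 / 2))%:E)%E.
  move=> b1; rewrite (normal_mgf _ _ tau0 nX) addr0 exprMn b1.
  by congr (expR _)%:E; field.
have key (x : R) : x ^+ 2 <= 2 * (expR x + expR (- x)).
  have pos (y : R) : 0 <= y -> y ^+ 2 <= 2 * expR y.
    move=> y0; rewrite mulrC -ler_pdivrMr//; apply: le_trans (expR_ge1Dxn 1 y0).
    by rewrite -[leLHS]add0r lerD.
  have [x0|x0] := leP 0 x.
    by rewrite mulrDr (le_trans (pos _ x0))// lerDl mulr_ge0 ?expR_ge0.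
  rewrite mulrDr -sqrrN (le_trans (pos (- x) _)) ?oppr_ge0 ?(ltW x0)//.
  by rewrite lerDr mulr_ge0 ?expR_ge0.
have c0 : 0 <= 2 * tau ^+ 2 by rewrite mulr_ge0// exprn_ge0// ltW.
have e0 b w : (0 <= (e b w)%:E)%E by rewrite lee_fin expR_ge0.
apply: (@le_trans _ _ (\int[P]_w ((2 * tau ^+ 2)%:E * ((e 1 w)%:E + (e (-1) w)%:E)))%E).
  apply: ge0_le_integral => //=.
  - by move=> w _; rewrite lee_fin sqr_ge0.
  - by apply/measurable_EFinP; exact: measurable_funX.
  - apply: emeasurable_funM => //; apply: emeasurable_funD; exact/measurable_EFinP.
  - move=> w _; rewrite -EFinD -EFinM lee_fin /e !addr0 mulN1r mulNr div1r.
    have := key (tau^-1 * X w); rewrite exprMn exprVn -ler_pdivlMl ?invr_gt0 ?exprn_gt0//.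
    by rewrite invrK mulrA [tau ^+ 2 * 2]mulrC.
rewrite ge0_integralZl//=; last 2 first.
- by apply: emeasurable_funD; exact/measurable_EFinP.
- by move=> w _; exact: adde_ge0.
rewrite ge0_integralD//=; last 2 first.
- exact/measurable_EFinP.
- exact/measurable_EFinP.
rewrite !Ee ?sqrrN ?expr1n// -EFinD -EFinM lee_fin le_eqVlt.
by apply/orP; left; apply/eqP; ring.
Qed.

End gaussian.

Section queue_lower.
Context {d : measure_display} {T : measurableType d} {R : realType}.
Variable P : probability T R.
Variables (sigma sigmaA : R) (W : nat -> R -> {RV P >-> R}) (WA : R -> {RV P >-> R}).
Hypotheses (sigma0 : 0 < sigma) (sigmaA0 : 0 < sigmaA).
Hypotheses (BW : forall i, brownian_motion sigma (W i)).
Hypothesis BA : brownian_motion sigmaA WA.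
Hypothesis indep : independent_processes P
    (fun k : option nat => if k is Some i then fun t => W i t : T -> R
                           else fun t => WA t : T -> R).

Let Q := max_queue W WA.

Lemma brownian_normal (s t : R) (B : R -> {RV P >-> R}) :
  brownian_motion s B -> 0 < t -> normal_rv P 0 (s * Num.sqrt t) (B t).
Proof.
move=> [B0 _ nB _] t0; have := nB 0 t (lexx 0) t0; rewrite subr0.
by congr (normal_rv _ _ _); apply/funext => w; rewrite /= B0 subr0.
Qed.

Lemma all_le_prob N (t y q : R) : 0 <= t ->
  (forall j, (q%:E <= P (W j t @^-1` `]y, +oo[))%E) ->
  (P (\bigcap_(j < N) (W j t @^-1` `]-oo, y])) <= (expR (- (N%:R * q)))%:E)%E.
Proof.
move=> t0 tail.
pose A (k : option nat) : set T := if k is Some j then W j t @^-1` `]-oo, y] else setT.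
pose J : seq (option nat) := map Some (iota 0 N).
have uJ : uniq J by rewrite map_inj_uniq ?iota_uniq// => ? ? [].
have H : P (\bigcap_(k in [set` J]) A k) = (\prod_(k <- J) P (A k))%E.
  apply: (indep uJ) => _ /mapP[j _ ->] /=.
  apply: sub_sigma_algebra; exists t => //; apply: preimage_algebra.
  exact: measurable_itv.
rewrite (_ : \bigcap_(j < N) _ = \bigcap_(k in [set` J]) A k); last first.
  apply/seteqP; split=> w H' /=.
    by move=> k /= /mapP[j]; rewrite mem_iota => jN -> /=; exact: H'.
  by move=> j /= jN; apply: (H' (Some j)); rewrite /= map_f// mem_iota.
rewrite H big_map.
have -> : iota 0 N = index_iota 0 N by rewrite /index_iota subn0.
elim: N {J uJ H} => [|N IH].
  by rewrite big_geq// mul0r oppr0 expR0.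
rewrite big_nat_recr//= -[N.+1]addn1 natrD mulrDl mul1r opprD expRD EFinM.
apply: lee_pmul => //.
  by apply: prode_ge0.
rewrite (_ : _ @^-1` _ = ~` (W N t @^-1` `]y, +oo[)); last first.
  by rewrite preimage_setC setCitvr.
rewrite probability_setC; last first.
  by rewrite -[_ @^-1` _]setTI; exact: measurable_funP.
apply: (@le_trans _ _ (1 - q%:E)%E); first by rewrite leeB.
by rewrite -EFinB lee_fin; apply: le_trans (expR_ge1Dx _).
Qed.

Section fixed.
Variables (N : nat) (eps : R).
Hypotheses (N2 : (2 <= N)%N) (eps0 : 0 < eps) (eps1 : eps <= 1).

Let L : R := ln N%:R.
Let st : R := sigma ^+ 2 * L / 2.
Let a : R := Num.sqrt (2 * L).

Hypothesis eps_a : eps <= a.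

Let tau : R := sigma * Num.sqrt st.

Let N0 : 0 < N%:R :> R. Proof. by rewrite ltr0n (leq_trans _ N2). Qed.
Let L0 : 0 < L. Proof. by rewrite ln_gt0// ltr1n. Qed.
Let st0 : 0 < st. Proof. by rewrite divr_gt0// mulr_gt0// exprn_gt0. Qed.
Let a0 : 0 < a. Proof. by rewrite sqrtr_gt0 mulr_gt0. Qed.
Let tau0 : 0 < tau. Proof. by rewrite mulr_gt0// sqrtr_gt0. Qed.

Let a2 : a ^+ 2 = 2 * L. Proof. by rewrite sqr_sqrtr// mulr_ge0// ltW. Qed.

Let tauE : tau = sigma ^+ 2 * a / 2.
Proof.
rewrite /tau (_ : st = (sigma * a / 2) ^+ 2); last first.
  by rewrite /st !exprMn a2; field.
by rewrite sqrtr_sqr gtr0_norm ?divr_gt0 ?mulr_gt0//; field.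
Qed.

Let tau_a : tau * a = 2 * st.
Proof.
rewrite tauE /st (_ : _ / 2 * a = sigma ^+ 2 * a ^+ 2 / 2); last by field.
by rewrite a2; field.
Qed.

Let q : R := gauss_const * eps * expR (- (a ^+ 2 / 2) + a * eps / 2).

Let y : R := tau * (a - eps).

Let A := \bigcap_(j < N) (W j st @^-1` `]-oo, y]).

Let mA : measurable A.
Proof.
apply: bigcap_measurableType => j _; rewrite -[_ @^-1` _]setTI.
exact: measurable_funP.
Qed.

Let A_le : (P A <= (8 / (gauss_const * eps ^+ 3 * a ^+ 2))%:E)%E.
Proof.
have g0 := @gauss_const_gt0 R.
have NqE : N%:R * q = gauss_const * eps * expR (a * eps / 2).
  rewrite /q a2 (_ : 2 * L / 2 = L); last by field.
  by rewrite expRD expRN lnK ?posrE//; field; rewrite gt_eqF.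
have z0 : 0 < gauss_const * eps ^+ 3 * a ^+ 2 / 8.
  by apply: divr_gt0 => //; apply: mulr_gt0; [apply: mulr_gt0 => //|]; exact: exprn_gt0.
have zq : gauss_const * eps ^+ 3 * a ^+ 2 / 8 <= N%:R * q.
  have x0 : 0 <= a * eps / 2 by rewrite divr_ge0// mulr_ge0// ltW.
  rewrite NqE (_ : _ / 8 = gauss_const * eps * ((a * eps / 2) ^+ 2 / 2)); last by field.
  apply: ler_wpM2l; first by rewrite mulr_ge0 ?ltW.
  by apply: le_trans (expR_ge1Dxn 1 x0); rewrite -[leLHS]add0r lerD.
apply: le_trans (@all_le_prob N st y q (ltW st0) _) _.
  by move=> j; apply: normal_tail_ge => //; exact: brownian_normal (BW j) st0.
rewrite lee_fin expRN (_ : 8 / _ = (gauss_const * eps ^+ 3 * a ^+ 2 / 8)^-1); last first.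
  by rewrite invf_div.
rewrite lef_pV2 ?posrE ?expR_gt0//; apply: le_trans (expR_ge1Dx _).
by rewrite (le_trans zq)// lerDr.
Qed.

Lemma max_queue_lower :
  (\int[P]_w (Num.max (st + WA st w - max_of Q N w) 0)%:E
   <= (sigma ^+ 2 * (a * eps + 16 / (gauss_const * eps ^+ 3)
                     + 4 * expR (1 / 2)) / 2)%:E)%E.
Proof.
pose K := tau * a.
have K0 : 0 < K by rewrite mulr_gt0.
have KE : K = 2 * st := tau_a.
pose g w := tau * eps + 2 * K * \1_A w + (W 0%N st w) ^+ 2 / K.
have mg : measurable_fun setT g.
  apply: measurable_funD; last first.
    by apply: measurable_funM => //; exact: measurable_funX.
  by apply: measurable_funD => //; apply: measurable_funM => //; exact: measurable_indic.
have te0 : 0 <= tau * eps := mulr_ge0 (ltW tau0) (ltW eps0).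
have K20 : 0 <= 2 * K := mulr_ge0 (ler0n _ 2) (ltW K0).
have KA0 w : 0 <= 2 * K * \1_A w by apply: mulr_ge0 => //; exact: ler0n.
have WK0 w : 0 <= (W 0%N st w) ^+ 2 / K := divr_ge0 (sqr_ge0 _) (ltW K0).
have g0 w : 0 <= g w by rewrite addr_ge0// addr_ge0.
have mM : measurable_fun setT (fun w => Num.max (st + WA st w - max_of Q N w) 0).
  apply: measurable_maxr => //; apply: measurable_funB; first exact: measurable_funD.
  by apply: measurable_max_of => j; exact: (measurable_max_queue BW BA).
apply: (@le_trans _ _ (\int[P]_w (g w)%:E)%E).
  apply: ae_ge0_le_integral => //.
  - by move=> w _; rewrite lee_fin le_max lexx orbT.
  - exact/measurable_EFinP.
  - by move=> w _; rewrite lee_fin.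
  - exact/measurable_EFinP.
  have : {ae P, forall w, forall j, bounded_netput W WA j w}.
    by apply/ae_foralln => j; exact: (ae_bounded_netput sigma0 sigmaA0 BW BA).
  apply: filterS => w bw _; rewrite lee_fin ge_max g0 andbT.
  have Mge j : (j < N)%N -> W j st w + WA st w - st <= max_of Q N w.
    move=> jN; apply: le_trans (max_of_ge Q w jN).
    exact: (netput_le (bw j) st0).
  have [Aw|/existsNP[j /not_implyP[/= jN]]] := pselect (A w).
    have /Mge : (0 < N)%N by exact: leq_trans N2.
    rewrite /g indicE mem_set//.
    set x := W _ _ _; set m := max_of _ _ _; set z := WA _ _ => H.
    have : - x <= K + x ^+ 2 / K.
      rewrite -subr_ge0 (_ : _ - _ = ((x + K / 2) ^+ 2 + 3 * K ^+ 2 / 4) / K).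
        apply: divr_ge0; last exact: ltW.
        apply: addr_ge0; first exact: sqr_ge0.
        by apply: divr_ge0 => //; apply: mulr_ge0 => //; exact: sqr_ge0.
      by field; rewrite gt_eqF.
    by rewrite mulr1; move: te0 H KE; lra.
  rewrite /= in_itv/= => /negP; rewrite -ltNge /y => yW.
  have := Mge j jN.
  have : 0 <= 2 * K * \1_A w + (W 0%N st w) ^+ 2 / K.
    exact: addr_ge0.
  rewrite /g -[X in _ -> _ -> _ <= X]addrA.
  by move: yW tau_a; rewrite mulrBr; lra.
under eq_integral do rewrite /g !EFinD.
rewrite ge0_integralD//=; first last.
- by apply/measurable_EFinP; apply: measurable_funM => //; exact: measurable_funX.
- by move=> w _; rewrite lee_fin.
- apply: emeasurable_funD => //; apply/measurable_EFinP; apply: measurable_funM => //.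
- by move=> w _; rewrite -EFinD lee_fin addr_ge0.
rewrite ge0_integralD//=; first last.
- by apply/measurable_EFinP; apply: measurable_funM => //.
- by move=> w _; rewrite lee_fin.
rewrite integral_cst//.
under eq_integral do rewrite EFinM.
rewrite ge0_integralZl//=; last exact/measurable_EFinP.
rewrite integral_indic// setIT.
under [X in (_ + X)%E]eq_integral do rewrite mulrC EFinM.
rewrite ge0_integralZl//=; last 3 first.
- by apply/measurable_EFinP; exact: measurable_funX.
- by move=> w _; rewrite lee_fin sqr_ge0.
- by rewrite lee_fin invr_ge0 ltW.
apply: (@le_trans _ _ ((tau * eps)%:E + (2 * K)%:E *
    (8 / (gauss_const * eps ^+ 3 * a ^+ 2))%:E +
    K^-1%:E * (4 * expR (1 / 2) * tau ^+ 2)%:E)%E).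
  apply: leeD; first apply: leeD.
  - rewrite -[leRHS]mule1 lee_wpmul2l ?lee_fin//.
    exact: probability_le1.
  - by apply: lee_wpmul2l => //; rewrite lee_fin.
  - apply: lee_wpmul2l; first by rewrite lee_fin invr_ge0 ltW.
    exact: normal_second_moment tau0 (brownian_normal (BW 0) st0).
rewrite -!EFinM -!EFinD lee_fin le_eqVlt; apply/orP; left; apply/eqP.
rewrite /K tauE; field.
by rewrite !gt_eqF// gauss_const_gt0.
Qed.

End fixed.
End queue_lower.

Lemma sqrt_ln_large (R : realType) (c : R) :
  \forall N \near \oo, c <= Num.sqrt (ln N%:R).
Proof.
exists (Num.truncn (expR (c ^+ 2))).+1 => //= N cN.
apply: le_trans (ler_norm c) _; rewrite -sqrtr_sqr ler_sqrt; last first.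
  rewrite ln_ge0// (ler_nat R 1); exact: leq_trans cN.
rewrite -[leLHS]expRK ler_ln ?posrE ?expR_gt0//; last first.
  by rewrite ltr0n; exact: leq_trans cN.
by apply: (le_trans (ltW (truncnS_gt _))); rewrite ler_nat.
Qed.

Section coupling.
Context {d : measure_display} {T : measurableType d} {R : realType}.
Variable P : probability T R.
Variables (sigma sigmaA : R) (W : nat -> R -> {RV P >-> R}) (WA : R -> {RV P >-> R}).
Hypotheses (sigma0 : 0 < sigma) (sigmaA0 : 0 < sigmaA).
Hypotheses (BW : forall i, brownian_motion sigma (W i)).
Hypothesis BA : brownian_motion sigmaA WA.
Hypothesis indep : independent_processes P
    (fun k : option nat => if k is Some i then fun t => W i t : T -> R
                           else fun t => WA t : T -> R).

Let Q := max_queue W WA.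
Let st N : R := sigma ^+ 2 * ln N%:R / 2.

Let r N : R := Num.sqrt (ln N%:R).
Let D (eps : R) : R := 16 / (gauss_const * eps ^+ 3) + 4 * expR (1 / 2).
Let coupling_const (eps : R) : R :=
  4 * (sigma ^+ 2 + sigmaA ^+ 2) / eps + sigma ^+ 2 * D eps / 2.

Lemma queue_coupling_le N (eps : R) : (2 <= N)%N -> 0 < eps -> eps <= 1 -> 4 <= r N ->
  (\int[P]_w `|max_of Q N w - (st N + WA (st N) w)|%:E
   <= (2 * sigma ^+ 2 * eps * r N + coupling_const eps * Num.sqrt (r N))%:E)%E.
Proof.
move=> N2 eps0 eps1; rewrite /coupling_const; set rN := r N => r4.
have L0 : 0 < ln N%:R :> R by rewrite ln_gt0// ltr1n.
have r0 : 0 < rN by apply: lt_le_trans r4.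
have r2 : rN ^+ 2 = ln N%:R by rewrite sqr_sqrtr// ltW.
set v := Num.sqrt rN.
have v0 : 0 < v by rewrite sqrtr_gt0.
have v2 : v ^+ 2 = rN by rewrite sqr_sqrtr// ltW.
have v_ge2 : 2 <= v by rewrite -ler_sqr ?nnegrE ?(ltW v0)// v2 expr2 -natrM.
pose delta := eps / v.
have delta0 : 0 < delta by rewrite divr_gt0.
have delta_half : delta <= 1 / 2.
  by rewrite ler_pdivlMr// /delta mulrAC ler_pdivrMr// mul1r (le_trans _ v_ge2)// ler_piMl.
pose a : R := Num.sqrt (2 * ln N%:R).
have a2r : a <= 2 * rN.
  rewrite -ler_sqr ?nnegrE ?sqrtr_ge0// ?mulr_ge0 ?(ltW r0)//.
  rewrite sqr_sqrtr ?mulr_ge0 ?(ltW L0)// exprMn r2 ler_wpM2r ?(ltW L0)//.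
  by rewrite expr2 -natrM ler_nat.
have epsa : eps <= a.
  apply: le_trans eps1 _; rewrite -sqrtr1 ler_sqrt ?mulr_ge0 ?(ltW L0)// -r2.
  have : 1 <= rN by apply: le_trans r4; rewrite (ler_nat R 1).
  nra.
have mM : measurable_fun setT (fun w => max_of Q N w - (st N + WA (st N) w)).
  apply: measurable_funB; last exact: measurable_funD.
  by apply: measurable_max_of => j; exact: (measurable_max_queue BW BA).
have up := max_queue_upper sigma0 sigmaA0 BW BA N2 delta0 delta_half.
have low := max_queue_lower sigma0 sigmaA0 BW BA indep N2 eps0 eps1 epsa.
rewrite -/(st N) in up low.
have posN x y : Num.max (x - y) 0 + Num.max (y - x) 0 = `|x - y| :> R.
  have [xy|xy] := leP x y.
    have /max_idPr -> : x - y <= 0 by rewrite subr_le0.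
    have /max_idPl -> : 0 <= y - x by rewrite subr_ge0.
    by rewrite add0r ler0_norm ?opprB ?subr_le0.
  have /max_idPl -> : 0 <= x - y by rewrite subr_ge0 ltW.
  have /max_idPr -> : y - x <= 0 by rewrite subr_le0 ltW.
  by rewrite addr0 gtr0_norm ?subr_gt0.
under eq_integral do rewrite -posN EFinD.
rewrite ge0_integralD//=; last 4 first.
- by move=> w _; rewrite lee_fin le_max lexx orbT.
- by apply/measurable_EFinP; exact: measurable_maxr.
- by move=> w _; rewrite lee_fin le_max lexx orbT.
- apply/measurable_EFinP; apply: measurable_maxr => //.
  rewrite (_ : (fun _ => _) = (\- (fun w => max_of Q N w - (st N + WA (st N) w)))).
    exact: measurable_funN.
  by apply/funext => w /=; rewrite opprB.
apply: le_trans (leeD up low) _; rewrite -EFinD lee_fin.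
have D0 : 0 <= D eps.
  apply: addr_ge0; last by rewrite mulr_ge0// expR_ge0.
  apply: divr_ge0 => //; apply: mulr_ge0; first exact: ltW (@gauss_const_gt0 R).
  exact: exprn_ge0 (ltW eps0).
have s20 : 0 < sigma ^+ 2 by rewrite exprn_gt0.
have -> : 2 * st N * delta ^+ 2 = sigma ^+ 2 * eps ^+ 2 * rN.
  by rewrite /st -r2 /delta -v2; field; rewrite gt_eqF.
have -> : 8 / (delta * 2 / (sigma ^+ 2 + sigmaA ^+ 2)) =
    4 * (sigma ^+ 2 + sigmaA ^+ 2) / eps * v.
  by rewrite /delta; field; rewrite !gt_eqF// addr_gt0// exprn_gt0.
rewrite -/a -[a * eps + _ + _]addrA -/(D eps).
have h1 : sigma ^+ 2 * eps ^+ 2 * rN <= sigma ^+ 2 * eps * rN.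
  apply: ler_wpM2r; first exact: ltW.
  apply: ler_wpM2l; first exact: ltW.
  by rewrite [leLHS]expr2 ler_piMl// ltW.
have h2 : sigma ^+ 2 * (a * eps) <= sigma ^+ 2 * (2 * rN * eps).
  by rewrite ler_wpM2l ?(ltW s20)// ler_wpM2r// ltW.
have h3 : sigma ^+ 2 * D eps / 2 <= sigma ^+ 2 * D eps / 2 * v.
  rewrite ler_peMr//; last by rewrite (le_trans _ v_ge2)// ler1n.
  by apply: divr_ge0 => //; apply: mulr_ge0 => //; exact: ltW.
move: h1 h2 h3; lra.
Qed.

End coupling.

Section excess.
Context {d : measure_display} {T : measurableType d} {R : realType}.
Variable P : probability T R.
Implicit Types Y M : T -> R.

Definition excess M (I : R) : R := \int[P]_w Num.max (M w - I) 0.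

Lemma integrable_cst (k : R) : P.-integrable setT (EFin \o cst k).
Proof. exact: finite_measure_integrable_cst. Qed.

Lemma integrable_excess M (I : R) : P.-integrable setT (EFin \o M) ->
  P.-integrable setT (EFin \o (fun w => Num.max (M w - I) 0)).
Proof.
move=> iM; have iMI : P.-integrable setT (EFin \o (fun w => M w - I)).
  by apply: (integrableB _ iM (integrable_cst I)).
apply: le_integrable (iMI) => //.
  apply/measurable_EFinP; apply: measurable_maxr => //.
  exact/measurable_EFinP/(measurable_int P).
move=> w _; rewrite lee_fin/=.
rewrite [X in X <= _]ger0_norm ?le_max ?lexx ?orbT//.
by rewrite ge_max ler_norm normr_ge0.
Qed.

Lemma expected_costE (h b : R) N Y M (I : R) :
  P.-integrable setT (EFin \o Y) -> P.-integrable setT (EFin \o M) ->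
  expected_cost P h b N Y M I =
  N%:R * h * (I - \int[P]_w Y w) + (N%:R * h + b) * excess M I.
Proof.
move=> iY iM; rewrite /expected_cost unlock.
have iIY : P.-integrable setT (EFin \o (fun w => I - Y w)).
  exact: (integrableB _ (integrable_cst I) iY).
have i1 : P.-integrable setT (EFin \o (fun w => N%:R * h * (I - Y w))).
  exact: (integrableZl _ _ iIY).
have i2 : P.-integrable setT
    (EFin \o (fun w => (N%:R * h + b) * Num.max (M w - I) 0)).
  exact: (integrableZl _ _ (integrable_excess I iM)).
rewrite -[LHS]/(\int[P]_w (N%:R * h * (I - Y w) + (N%:R * h + b) * Num.max (M w - I) 0)).
rewrite RintegralD// RintegralZl// RintegralZl//; last exact: integrable_excess.
rewrite RintegralB//; last exact: integrable_cst.
rewrite Rintegral_cst// [X in I * X](_ : _ = 1) ?mulr1//.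
exact: (congr1 fine (probability_setT P)).
Qed.

Lemma excess_dist M M' (I : R) :
  P.-integrable setT (EFin \o M) -> P.-integrable setT (EFin \o M') ->
  `|excess M I - excess M' I| <= \int[P]_w `|M w - M' w|.
Proof.
move=> iM iM'; have i1 := integrable_excess I iM; have i2 := integrable_excess I iM'.
rewrite /excess -RintegralB//; apply: le_trans (le_normr_Rintegral _ _) _ => //.
  exact: (integrableB _ i1 i2).
have iMM' : P.-integrable setT (EFin \o (fun w => M w - M' w)).
  exact: (integrableB _ iM iM').
apply: le_Rintegral => //.
- by apply: integrable_norm => //; exact: (integrableB _ i1 i2).
- exact: integrable_norm.
move=> w _ /=; set x := M w; set y := M' w.
have := ler_norm (x - y); have := ler_norm (y - x); rewrite distrC ler_norml.
by case: (leP (x - I) 0) => xI; case: (leP (y - I) 0) => yI; lra.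
Qed.

End excess.

Lemma minimizer_ratio (R : realType) (n B e l : R) (c c' : R -> R)
    (Is bs Ih bh : R) : 0 <= n -> 0 < B -> 0 <= e -> e < l ->
  (forall I, `|c I - c' I| <= e) -> (forall I, l <= c' I) ->
  is_minimizer (fun I b => b^-1 * (B * c I) + b * n) Is bs ->
  is_minimizer (fun I b => b^-1 * (B * c' I) + b * n) Ih bh ->
  `| (bs^-1 * (B * c Is) + bs * n) / (bh^-1 * (B * c Ih) + bh * n) - 1 | <= 2 * (e / l).
Proof.
move=> n0 B0 e0 el cc' lc' [bs0 mins] [bh0 minh].
have l0 : 0 < l by apply: le_lt_trans el.
set eta := e / l.
have eta0 : 0 <= eta by rewrite divr_ge0// ltW.
have eta1 : eta < 1 by rewrite ltr_pdivrMr// mul1r.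
have ele I : e <= eta * c' I.
  have := ler_wpM2l eta0 (lc' I); rewrite {1}/eta divfK ?gt_eqF//.
pose F (I b : R) := b^-1 * (B * c I) + b * n.
pose F' (I b : R) := b^-1 * (B * c' I) + b * n.
have lower I b : 0 < b -> (1 - eta) * F' I b <= F I b.
  move=> b0; have : 0 <= b^-1 * B * (c I - (1 - eta) * c' I).
    apply: mulr_ge0; first by apply: mulr_ge0; rewrite ?invr_ge0 ltW.
    by have := cc' I; have := ele I; rewrite ler_norml => ? /andP[? _]; lra.
  have : 0 <= eta * (b * n) := mulr_ge0 eta0 (mulr_ge0 (ltW b0) n0).
  by rewrite /F /F'; lra.
have upper I b : 0 < b -> F I b <= (1 + eta) * F' I b.
  move=> b0; have : 0 <= b^-1 * B * ((1 + eta) * c' I - c I).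
    apply: mulr_ge0; first by apply: mulr_ge0; rewrite ?invr_ge0 ltW.
    by have := cc' I; have := ele I; rewrite ler_norml => ? /andP[_ ?]; lra.
  have : 0 <= eta * (b * n) := mulr_ge0 eta0 (mulr_ge0 (ltW b0) n0).
  by rewrite /F /F'; lra.
have F'0 : 0 < F' Ih bh.
  apply: ltr_wpDr; first by rewrite mulr_ge0// ltW.
  by rewrite mulr_gt0 ?invr_gt0// mulr_gt0// (lt_le_trans l0).
rewrite -/(F Is bs) -/(F Ih bh).
have s1 : F Is bs <= F Ih bh := mins _ _ bh0.
have s2 : (1 - eta) * F' Ih bh <= F Is bs.
  apply: le_trans (lower _ _ bs0); apply: ler_wpM2l; first by rewrite subr_ge0 ltW.
  exact: minh.
have s3 := upper Ih bh bh0.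
have F0 : 0 < F Ih bh.
  by apply: lt_le_trans s1; apply: lt_le_trans s2; rewrite mulr_gt0// subr_gt0.
rewrite ler_norml; apply/andP; split; last first.
  by rewrite lerBlDr (@le_trans _ _ 1)// ?ler_pdivrMr ?mul1r// lerDr mulr_ge0.
rewrite lerBrDr ler_pdivlMr//.
have [h|h] := leP 0 (1 - 2 * eta); last first.
  have : (1 - 2 * eta) * F Ih bh <= 0 by rewrite nmulr_rle0// ltW.
  have : 0 <= (1 - eta) * F' Ih bh.
    by apply: mulr_ge0; rewrite ?subr_ge0 ltW.
  by lra.
have := ler_wpM2l h s3.
have : 0 <= eta ^+ 2 * F' Ih bh := mulr_ge0 (sqr_ge0 eta) (ltW F'0).
by nra.
Qed.

Section limit.
Context {d : measure_display} {T : measurableType d} {R : realType}.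
Variable P : probability T R.
Variables (sigma sigmaA : R) (W : nat -> R -> {RV P >-> R}) (WA : R -> {RV P >-> R}).
Hypotheses (sigma0 : 0 < sigma) (sigmaA0 : 0 < sigmaA).
Hypotheses (BW : forall i, brownian_motion sigma (W i)).
Hypothesis BA : brownian_motion sigmaA WA.
Hypothesis indep : independent_processes P
    (fun k : option nat => if k is Some i then fun t => W i t : T -> R
                           else fun t => WA t : T -> R).

Let Q := max_queue W WA.
Let st N : R := sigma ^+ 2 * ln N%:R / 2.
Let r N : R := Num.sqrt (ln N%:R).

Lemma queue_coupling (e : R) : 0 < e -> \forall N \near \oo,
  (\int[P]_w `|max_of Q N w - (st N + WA (st N) w)|%:E <= (e * r N)%:E)%E.
Proof.
move=> e0.
have s20 : 0 < sigma ^+ 2 by rewrite exprn_gt0.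
pose eps := Num.min 1 (e / (4 * sigma ^+ 2)).
have eps0 : 0 < eps by rewrite lt_min ltr01 divr_gt0// mulr_gt0.
have eps1 : eps <= 1 by rewrite ge_min lexx.
have eps2 : 4 * sigma ^+ 2 * eps <= e.
  by rewrite mulrC -ler_pdivlMr ?mulr_gt0// ge_min lexx orbT.
set C : R := 4 * (sigma ^+ 2 + sigmaA ^+ 2) / eps +
   sigma ^+ 2 * (16 / (gauss_const * eps ^+ 3) + 4 * expR (1 / 2)) / 2.
near=> N.
have N2 : (2 <= N)%N by near: N; exact: nbhs_infty_ge.
have r4 : 4 <= r N by near: N; exact: sqrt_ln_large.
have rC : (2 * C / e) ^+ 2 <= r N by near: N; exact: sqrt_ln_large.
apply: le_trans (queue_coupling_le sigma0 sigmaA0 BW BA indep N2 eps0 eps1 r4) _.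
rewrite lee_fin -/C -/(r N).
have r0 : 0 <= r N by exact: sqrtr_ge0.
have v2 : Num.sqrt (r N) ^+ 2 = r N by rewrite sqr_sqrtr.
have Cv : 2 * C <= e * Num.sqrt (r N).
  rewrite -ler_pdivrMl// [leLHS]mulrC.
  apply: le_trans (ler_norm _) _; by rewrite -sqrtr_sqr ler_sqrt.
have := ler_wpM2r (sqrtr_ge0 (r N)) Cv.
have := ler_wpM2r r0 eps2.
rewrite -[e * _ * _]mulrA -expr2 v2; lra.
Unshelve. all: by end_near. Qed.

End limit.

Lemma normal_integrable d (T : measurableType d) (R : realType)
    (P : probability T R) (tau : R) (X : {RV P >-> R}) :
  0 < tau -> normal_rv P 0 tau X -> P.-integrable setT (EFin \o X).
Proof.
move=> tau0 nX.
have iX2 : P.-integrable setT (EFin \o (fun w => 1 + (X w) ^+ 2)).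
  suff iX : P.-integrable setT (EFin \o (fun w => (X w) ^+ 2)).
    exact: (integrableD _ (integrable_cst P 1) iX).
  apply/integrableP; split; first by apply/measurable_EFinP; exact: measurable_funX.
  under eq_integral do rewrite /= ger0_norm ?sqr_ge0//.
  exact: le_lt_trans (normal_second_moment tau0 nX) (ltry _).
apply: le_integrable iX2 => //; first exact/measurable_EFinP.
move=> w _; rewrite lee_fin [leRHS]ger0_norm ?addr_ge0 ?sqr_ge0// -real_normK ?num_real//.
by have := sqr_ge0 (`|X w| - 1 / 2); rewrite sqrrB; nra.
Qed.

Theorem theorem5p11 (R : realType) (d : measure_display) (T : measurableType d)
  (P : probability T R) (sigma sigmaA : R)
  (W : nat -> R -> {RV P >-> R}) (WA : R -> {RV P >-> R}) (X : {RV P >-> R})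
  (h b : nat -> R) (gamma : R) (IA betaA IhatA betahatA : nat -> R) :
  let Q := max_queue W WA in
  let F := total_cost (C P h b Q) in
  let Fhat := total_cost (Chat P sigma sigmaA h b Q X) in
  0 < sigma -> 0 < sigmaA ->
  (forall i, brownian_motion sigma (W i)) ->
  brownian_motion sigmaA WA ->
  independent_processes P
    (fun k : option nat => if k is Some i then fun t => W i t : T -> R
                           else fun t => WA t : T -> R) ->
  normal_rv P 0 1 X ->
  (forall N, (2 <= N)%N -> 0 < h N) ->
  (forall N, (2 <= N)%N -> 0 < b N) ->
  0 < gamma < 1 ->
  (forall N, (2 <= N)%N -> N%:R * h N / (N%:R * h N + b N) = gamma) ->
  (forall N, (2 <= N)%N -> is_minimizer (F N) (IA N) (betaA N)) ->
  (\forall N \near \oo, is_minimizer (Fhat N) (IhatA N) (betahatA N)) ->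
  (fun N : nat =>
     `|F N (IA N) (betaA N) / F N (IhatA N) (betahatA N) - 1| : R^o)
    =o_\oo (fun N : nat => (Num.sqrt (ln N%:R))^-1 : R^o).
Proof.
move=> Q F Fhat sigma0 sigmaA0 BW BA indep nX h0 b0 /andP[g0 g1] gE minF minFhat.
pose st N : R := sigma ^+ 2 * ln N%:R / 2.
pose r N : R := Num.sqrt (ln N%:R).
pose k1 : R := sigma * sigmaA / Num.sqrt 2.
pose kappa : R := \int[P]_w Q 0%N w.
pose xi : R := \int[P]_w `|X w|.
pose Mhat N w : R := sigma ^+ 2 / 2 * ln N%:R + k1 * r N * X w.
pose M' N w : R := st N + WA (st N) w.
pose B N := N%:R * h N + b N.
pose c N (I : R) := gamma * (I - kappa) + excess P (max_of Q N) I.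
pose c' N (I : R) := gamma * (I - kappa) + excess P (Mhat N) I.
have s20 : 0 < sigma ^+ 2 by rewrite exprn_gt0.
have k10 : 0 < k1 by rewrite divr_gt0 ?mulr_gt0 ?sqrtr_gt0.
have iX := normal_integrable ltr01 nX.
have iQ j : P.-integrable setT (EFin \o Q j).
  exact: (integrable_max_queue sigma0 sigmaA0 BW BA).
have kappa0 : 0 <= kappa.
  by apply: Rintegral_ge0 => w _; exact: (max_queue_ge0 BW BA).
have xi0 : 0 <= xi by apply: Rintegral_ge0.
have iMhat N : P.-integrable setT (EFin \o Mhat N).
  apply: (integrableD _ (integrable_cst P _) (integrableZl _ _ iX)) => //.
apply/eqoP => e e0; rewrite /=.
pose e1 : R := e * gamma * sigma ^+ 2 / 8.
have e10 : 0 < e1 by rewrite divr_gt0// !mulr_gt0.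
near=> N.
have N2 : (2 <= N)%N by near: N; exact: nbhs_infty_ge.
have L0 : 0 < ln N%:R :> R by rewrite ln_gt0// ltr1n.
have r0 : 0 < r N by rewrite sqrtr_gt0.
have r2 : r N ^+ 2 = ln N%:R by rewrite sqr_sqrtr// ltW.
have st0 : 0 < st N by rewrite divr_gt0// mulr_gt0.
have N0 : 0 < N%:R :> R by rewrite ltr0n (leq_trans _ N2).
have B0 : 0 < B N by rewrite addr_gt0 ?mulr_gt0 ?h0 ?b0.
have hB : N%:R * h N = gamma * B N by rewrite -(gE N N2) divfK// gt_eqF.
have coupling : (\int[P]_w `|max_of Q N w - M' N w|%:E <= (e1 * r N)%:E)%E.
  near: N; exact: (queue_coupling sigma0 sigmaA0 BW BA indep e10).
have kE : sigmaA * Num.sqrt (st N) = k1 * r N.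
  rewrite /st -mulrA sqrtrM ?(ltW s20)// sqrtr_sqr (gtr0_norm sigma0).
  rewrite sqrtrM ?(ltW L0)// sqrtrV// /k1 -/(r N).
  by ring.
have iWA : P.-integrable setT (EFin \o WA (st N)).
  by apply: (normal_integrable _ (brownian_normal BA st0)); rewrite kE mulr_gt0.
have iM' : P.-integrable setT (EFin \o M' N).
  exact: (integrableD _ (integrable_cst P _) iWA).
have iMM' : P.-integrable setT (EFin \o (fun w => max_of Q N w - M' N w)).
  apply/integrableP; split; last exact: le_lt_trans coupling (ltry _).
  apply/measurable_EFinP; apply: measurable_funB.
    by apply: measurable_max_of => j; exact: (measurable_max_queue BW BA).
  exact: measurable_funD.
have iM : P.-integrable setT (EFin \o max_of Q N).
  apply: eq_integrable (integrableD _ iMM' iM') => // w _ /=.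
  by rewrite -EFinD subrK.
have excessE I : excess P (Mhat N) I = excess P (M' N) I.
  have kr0 : 0 < k1 * r N by rewrite mulr_gt0.
  have nWA : normal_rv P 0 (k1 * r N) (WA (st N)) by rewrite -kE; exact: brownian_normal.
  pose f (y : R) := (Num.max (st N + y - I) 0)%:E.
  rewrite /excess /Rintegral; congr fine.
  rewrite [RHS](@ge0_integral_normal_scale _ _ _ P (k1 * r N) X (WA (st N)) f) //.
  - by apply: eq_integral => w _; rewrite /f /Mhat /st; congr (Num.max (_ + _ - _) _)%:E; ring.
  - apply/measurable_EFinP; apply: measurable_maxr => //.
    by apply: measurable_funB => //; exact: measurable_funD.
  - by move=> y; rewrite lee_fin le_max lexx orbT.
have cc' I : `|c N I - c' N I| <= e1 * r N.
  rewrite /c /c' excessE (_ : _ - _ = excess P (max_of Q N) I - excess P (M' N) I); last by ring.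
  apply: le_trans (excess_dist I iM iM') _.
  rewrite -lee_fin; apply: le_trans coupling; rewrite /Rintegral fineK//.
  by apply: integrable_fin_num => //; exact: integrable_norm.
pose l := gamma * (st N - k1 * r N * xi - kappa).
have lc' I : l <= c' N I.
  have ex0 : 0 <= excess P (Mhat N) I.
    by apply: Rintegral_ge0 => w _; rewrite le_max lexx orbT.
  have iabs : P.-integrable setT (EFin \o (fun w => k1 * r N * `|X w|)).
    have iX' : P.-integrable setT (EFin \o (fun w => `|X w|)) by exact: integrable_norm.
    exact: (integrableZl _ _ iX').
  have ex1 : st N - I - k1 * r N * xi <= excess P (Mhat N) I.
    rewrite /xi -RintegralZl//; last exact: integrable_norm.
    have cE : \int[P]_w (st N - I) = st N - I.
      by rewrite Rintegral_cst// [X in _ * X](congr1 fine (probability_setT P)) mulr1.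
    rewrite -[X in X - _]cE -RintegralB//; last exact: integrable_cst.
    apply: le_Rintegral => //.
    - exact: (integrableB _ (integrable_cst P _) iabs).
    - exact: integrable_excess.
    move=> w _; rewrite le_max; apply/orP; left; rewrite /Mhat /st.
    have : - `|X w| <= X w by rewrite lerNl ler_normr lexx orbT.
    by move=> /(ler_wpM2l (ltW (mulr_gt0 k10 r0))); lra.
  rewrite /l /c'; move: (ler_wpM2l (ltW g0) ex1).
  have : 0 <= (1 - gamma) * excess P (Mhat N) I by rewrite mulr_ge0// subr_ge0 ltW.
  by lra.
have r1 : 1 <= r N by near: N; exact: sqrt_ln_large.
have rk : 4 * (k1 * xi + kappa) / sigma ^+ 2 <= r N by near: N; exact: sqrt_ln_large.
have re : e <= r N by near: N; exact: sqrt_ln_large.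
have l_ge : gamma * sigma ^+ 2 * r N ^+ 2 / 4 <= l.
  rewrite /l (_ : _ / 4 = gamma * (sigma ^+ 2 * r N ^+ 2 / 4)); last by ring.
  apply: ler_wpM2l; first exact: ltW.
  rewrite /st -r2.
  have : 4 * (k1 * xi + kappa) <= r N * sigma ^+ 2 by rewrite -ler_pdivrMr.
  move=> /(ler_wpM2l (ltW r0)); have := ler_wpM2l kappa0 r1.
  by lra.
have el : e1 * r N < l.
  apply: lt_le_trans l_ge; rewrite /e1.
  have gs : 0 < gamma * sigma ^+ 2 * r N by rewrite !mulr_gt0.
  have := ler_wpM2l (ltW gs) re; have := mulr_gt0 gs r0.
  by lra.
have CE I : C P h b Q N I = B N * c N I.
  by rewrite /C expected_costE// -/(B N) hB /c -/kappa; ring.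
have ChatE I : Chat P sigma sigmaA h b Q X N I = B N * c' N I.
  rewrite /Chat (expected_costE _ _ _ _ (iQ 0%N) (iMhat N)) -/(B N) hB /c' -/kappa.
  ring.
have FE : F N = (fun I b => b^-1 * (B N * c N I) + b * N%:R).
  by apply/funext => I; apply/funext => y; rewrite /F /total_cost CE.
have FhatE : Fhat N = (fun I b => b^-1 * (B N * c' N I) + b * N%:R).
  by apply/funext => I; apply/funext => y; rewrite /Fhat /total_cost ChatE.
have m1 := minF N N2.
have m2 : is_minimizer (Fhat N) (IhatA N) (betahatA N) by near: N.
rewrite FE in m1; rewrite FhatE in m2.
have := minimizer_ratio (ltW N0) B0 (ltW (mulr_gt0 e10 r0)) el cc' lc' m1 m2.
rewrite FE normr_id (ger0_norm (_ : 0 <= (r N)^-1)) ?invr_ge0 ?sqrtr_ge0// => H.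
apply: le_trans H _.
have l0 : 0 < l by apply: lt_trans el; rewrite mulr_gt0.
rewrite mulrA ler_pdivrMr// (le_trans _ (ler_wpM2l _ l_ge))//; last first.
  by apply: divr_ge0; exact: ltW.
rewrite le_eqVlt; apply/orP; left; apply/eqP; rewrite /e1; field.
by rewrite gt_eqF.
Unshelve. all: by end_near. Qed.
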